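(* Let $$p_i(c;x)=x_i^{r_i}-c_ix^{\beta_i},\quad i=1,\dots,n,\qquad r_i>0,\ \beta_i\in\mathbb{N}^n,\ \beta_i\neq0,$$ be an irreducible binomial system, let $B$ be the $n\times n$ matrix whose $i$-th row is $r_ie_i-\beta_i$ ($e_i$ the $i$-th standard basis vector), and let $\delta=|\det B|$. Let $d$ be the total number of points, counted with multiplicity, of the zero set $\mathbb{V}_c\subset\bar k^n$ of $p_1(c;x),\dots,p_n(c;x)$ and $\mu$ the multiplicity of the origin, for generic $c\in(k^* )^n$. Then: (i) if all principal minors of $B$ are positive (such a system is called global), then $d=r_1\cdots r_n$ and $\mu=d-\delta$; (ii) otherwise (the system is then called local), $\mu=r_1\cdots r_n$ and $d=\mu+\delta$.
   Context: $k$ is a field of characteristic zero with algebraic closure $\bar k$; $\mathbb{N}$ includes $0$; $[n]=\{1,\dots,n\}$. A binomial system $p_j=x^{\alpha_j}-c_jx^{\beta_j}$, $j=1,\dots,n$ (always with $\alpha_j\ne\beta_j$), is in normal form if for each $i\in[n]$, $p_i=x_i^{r_i}-c_ix^{\beta_i}$ with $r_i>0$, $\beta_i\neq0$. It is irreducible if it is in normal form and there is no proper non-empty subset $I\subset[n]$ (possibly after reordering) such that for every $i\in I$ the binomial $p_i$ depends only on the variables $x_j$, $j\in I$. For $c\in(k^* )^n$, $\mathcal{J}_c\subset k[x_1,\dots,x_n]$ is the ideal generated by the $p_i(c;x)$; ''generic $c$'' means all $c$ in a non-empty Zariski open subset of $(k^* )^n$. For a system in normal form $\mathbb{V}_c$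 is finite and non-empty for generic $c$. The multiplicity of a point of $\mathbb{V}_c$ is the dimension over $\bar k$ of the local ring of $\bar k[x]/\mathcal{J}_c\bar k[x]$ at that point. *)

(* Defs.v *)
From HB Require Import structures.
From mathcomp Require Import all_boot all_order all_algebra.
From mathcomp Require Import boolp.
From mathcomp Require Import mpoly.
From mathcomp Require Import ring.

Set Implicit Arguments.
Unset Strict Implicit.
Unset Printing Implicit Defensive.

Import GRing.Theory.
Local Open Scope ring_scope.
Local Open Scope quotient_scope.

Definition in_ideal (A : comNzRingType) (m : nat) (q : 'I_m -> A) (f : A) : Prop :=
  exists g : 'I_m -> A, f = \sum_(i < m) g i * q i.

Lemma in_ideal0 (A : comNzRingType) m (q : 'I_m -> A) : in_ideal q 0.
Proof. by exists (fun=> 0); rewrite big1 // => i _; rewrite mul0r. Qed.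

Lemma in_idealD (A : comNzRingType) m (q : 'I_m -> A) f g :
  in_ideal q f -> in_ideal q g -> in_ideal q (f + g).
Proof.
move=> [a ->] [b ->]; exists (fun i => a i + b i).
by rewrite -big_split; apply: eq_bigr => i _; rewrite mulrDl.
Qed.

Lemma in_idealM (A : comNzRingType) m (q : 'I_m -> A) h f :
  in_ideal q f -> in_ideal q (h * f).
Proof.
move=> [a ->]; exists (fun i => h * a i).
by rewrite mulr_sumr; apply: eq_bigr => i _; rewrite mulrA.
Qed.

(* The local ring at the point [a] of [K[x]/J], where [J] is the ideal         *)
(* generated by the [q i]: fractions [f/s] with [s(a) != 0], where             *)
(* [f/s = g/t] iff [u (f t - g s)] lies in [J] for some [u] with [u(a) != 0].  *)
(* It is the zero ring when [a] is not a zero of [J].                          *)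
Section LocalRing.
Variables (K : fieldType) (n m : nat) (q : 'I_m -> {mpoly K[n]}).
Variable a : {ffun 'I_n -> K}.

Definition denom : Type := {s : {mpoly K[n]} | s.@[a] != 0}.
HB.instance Definition _ := Choice.on denom.

Lemma denom1_subproof : (1 : {mpoly K[n]}).@[a] != 0.
Proof. by rewrite meval1 oner_neq0. Qed.
Definition denom1 : denom :=
  exist (fun s : {mpoly K[n]} => s.@[a] != 0) 1 denom1_subproof.

Lemma denomM_subproof (s t : denom) : (sval s * sval t).@[a] != 0.
Proof. by rewrite mevalM mulf_neq0 ?(valP s) ?(valP t). Qed.
Definition denomM (s t : denom) : denom :=
  exist (fun s : {mpoly K[n]} => s.@[a] != 0) _ (denomM_subproof s t).

Definition prefrac : Type := ({mpoly K[n]} * denom)%type.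
HB.instance Definition _ := Choice.on prefrac.

Definition frac_equiv (x y : prefrac) : bool :=
  `[< exists2 u : {mpoly K[n]}, u.@[a] != 0 &
        in_ideal q (u * (x.1 * sval y.2 - y.1 * sval x.2)) >].

Lemma frac_equiv_eq (x y : prefrac) :
  x.1 * sval y.2 = y.1 * sval x.2 -> frac_equiv x y.
Proof.
move=> e; apply/asboolP; exists 1; first exact: denom1_subproof.
by rewrite e subrr mulr0; exact: in_ideal0.
Qed.

Lemma frac_equiv_is_equiv : equiv_class_of frac_equiv.
Proof.
have sym x y : frac_equiv x y -> frac_equiv y x.
  move=> /asboolP[u ua uJ]; apply/asboolP; exists u => //.
  rewrite (_ : u * _ = -1 * (u * (x.1 * sval y.2 - y.1 * sval x.2))); last by ring.
  exact: in_idealM.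
split=> [x|x y|y x z /asboolP[u ua uJ] /asboolP[v va vJ]].
- exact: frac_equiv_eq.
- by apply/idP/idP; apply: sym.
apply/asboolP; exists (u * v * sval y.2).
  by rewrite !mevalM !mulf_neq0 ?(valP y.2).
rewrite (_ : _ * _ =
    v * sval z.2 * (u * (x.1 * sval y.2 - y.1 * sval x.2)) +
    u * sval x.2 * (v * (y.1 * sval z.2 - z.1 * sval y.2))); last by ring.
by apply: in_idealD; apply: in_idealM.
Qed.

Canonical frac_equiv_equiv := EquivRelPack frac_equiv_is_equiv.

Definition local_ring : Type := {eq_quot frac_equiv}.
HB.instance Definition _ : EqQuotient prefrac frac_equiv local_ring :=
  EqQuotient.on local_ring.
HB.instance Definition _ := Choice.on local_ring.

Definition prefracD (x y : prefrac) : prefrac :=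
  (x.1 * sval y.2 + y.1 * sval x.2, denomM x.2 y.2).
Definition prefracN (x : prefrac) : prefrac := (- x.1, x.2).
Definition prefracM (x y : prefrac) : prefrac :=
  (x.1 * y.1, denomM x.2 y.2).
Definition prefracZ (b : K) (x : prefrac) : prefrac := (b *: x.1, x.2).

Definition locD := lift_op2 local_ring prefracD.
Definition locN := lift_op1 local_ring prefracN.
Definition locM := lift_op2 local_ring prefracM.
Definition loc0 : local_ring := \pi_local_ring (0, denom1).
Definition loc1 : local_ring := \pi_local_ring (1, denom1).
Definition locZ (b : K) := lift_op1 local_ring (prefracZ b).

Lemma pi_eqP (x y : prefrac) :
  reflect (\pi_local_ring x = \pi_local_ring y) (frac_equiv x y).
Proof. by apply: (iffP idP) => [h|/eqmodP]; first apply/eqmodP. Qed.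

Lemma pi_locD : {morph \pi_local_ring : x y / prefracD x y >-> locD x y}.
Proof.
move=> x y; unlock locD; apply/pi_eqP.
have /pi_eqP/asboolP[u ua uJ] : \pi_local_ring x = \pi_local_ring (repr (\pi_local_ring x)).
  by rewrite reprK.
have /pi_eqP/asboolP[v va vJ] : \pi_local_ring y = \pi_local_ring (repr (\pi_local_ring y)).
  by rewrite reprK.
move: (repr (\pi_local_ring x)) (repr (\pi_local_ring y)) uJ vJ => x' y' uJ vJ.
apply/asboolP; exists (u * v); first by rewrite mevalM mulf_neq0.
rewrite /prefracD /= (_ : _ * _ =
    v * sval y.2 * sval y'.2 * (u * (x.1 * sval x'.2 - x'.1 * sval x.2)) +
    u * sval x.2 * sval x'.2 * (v * (y.1 * sval y'.2 - y'.1 * sval y.2)));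
  last by ring.
by apply: in_idealD; apply: in_idealM.
Qed.

Lemma pi_locN : {morph \pi_local_ring : x / prefracN x >-> locN x}.
Proof.
move=> x; unlock locN; apply/pi_eqP.
have /pi_eqP/asboolP[u ua uJ] : \pi_local_ring x = \pi_local_ring (repr (\pi_local_ring x)).
  by rewrite reprK.
move: (repr _) uJ => x' uJ; apply/asboolP; exists u => //=.
rewrite (_ : _ * _ = -1 * (u * (x.1 * sval x'.2 - x'.1 * sval x.2))); last by ring.
exact: in_idealM.
Qed.

Lemma pi_locM : {morph \pi_local_ring : x y / prefracM x y >-> locM x y}.
Proof.
move=> x y; unlock locM; apply/pi_eqP.
have /pi_eqP/asboolP[u ua uJ] : \pi_local_ring x = \pi_local_ring (repr (\pi_local_ring x)).
  by rewrite reprK.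
have /pi_eqP/asboolP[v va vJ] : \pi_local_ring y = \pi_local_ring (repr (\pi_local_ring y)).
  by rewrite reprK.
move: (repr (\pi_local_ring x)) (repr (\pi_local_ring y)) uJ vJ => x' y' uJ vJ.
apply/asboolP; exists (u * v); first by rewrite mevalM mulf_neq0.
rewrite /prefracM /= (_ : _ * _ =
    v * y.1 * sval y'.2 * (u * (x.1 * sval x'.2 - x'.1 * sval x.2)) +
    u * x'.1 * sval x.2 * (v * (y.1 * sval y'.2 - y'.1 * sval y.2)));
  last by ring.
by apply: in_idealD; apply: in_idealM.
Qed.

Lemma pi_locZ b : {morph \pi_local_ring : x / prefracZ b x >-> locZ b x}.
Proof.
move=> x; unlock locZ; apply/pi_eqP.
have /pi_eqP/asboolP[u ua uJ] : \pi_local_ring x = \pi_local_ring (repr (\pi_local_ring x)).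
  by rewrite reprK.
move: (repr _) uJ => x' uJ; apply/asboolP; exists u => //=.
rewrite -!mul_mpolyC.
rewrite (_ : _ * _ = b%:MP * (u * (x.1 * sval x'.2 - x'.1 * sval x.2))); last by ring.
exact: in_idealM.
Qed.

Lemma locDA : associative locD.
Proof.
elim/quotW=> x; elim/quotW=> y; elim/quotW=> z.
by rewrite -!pi_locD; apply/pi_eqP/frac_equiv_eq => /=; ring.
Qed.

Lemma locDC : commutative locD.
Proof.
elim/quotW=> x; elim/quotW=> y.
by rewrite -!pi_locD; apply/pi_eqP/frac_equiv_eq => /=; ring.
Qed.

Lemma loc0D : left_id loc0 locD.
Proof.
by elim/quotW=> x; rewrite -!pi_locD; apply/pi_eqP/frac_equiv_eq => /=; ring.
Qed.

Lemma locND : left_inverse loc0 locN locD.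
Proof.
elim/quotW=> x; rewrite -!pi_locN -!pi_locD.
by apply/pi_eqP/frac_equiv_eq => /=; ring.
Qed.

HB.instance Definition _ :=
  GRing.isZmodule.Build local_ring locDA locDC loc0D locND.

Lemma locMA : associative locM.
Proof.
elim/quotW=> x; elim/quotW=> y; elim/quotW=> z.
by rewrite -!pi_locM; apply/pi_eqP/frac_equiv_eq => /=; ring.
Qed.

Lemma locMC : commutative locM.
Proof.
elim/quotW=> x; elim/quotW=> y.
by rewrite -!pi_locM; apply/pi_eqP/frac_equiv_eq => /=; ring.
Qed.

Lemma loc1M : left_id loc1 locM.
Proof.
by elim/quotW=> x; rewrite -!pi_locM; apply/pi_eqP/frac_equiv_eq => /=; ring.
Qed.

Lemma locMDl : left_distributive locM +%R.
Proof.
elim/quotW=> x; elim/quotW=> y; elim/quotW=> z.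
rewrite -[_ + _]/(locD _ _) -[RHS]/(locD _ _) -pi_locD -!pi_locM -pi_locD.
by apply/pi_eqP/frac_equiv_eq => /=; ring.
Qed.

HB.instance Definition _ :=
  GRing.Zmodule_isComPzRing.Build local_ring locMA locMC loc1M locMDl.

Lemma locZA b c v : locZ b (locZ c v) = locZ (b * c) v.
Proof.
elim/quotW: v => x; rewrite -!pi_locZ.
by apply/pi_eqP/frac_equiv_eq => /=; rewrite scalerA.
Qed.

Lemma loc1Z : left_id 1 locZ.
Proof.
elim/quotW=> x; rewrite -!pi_locZ.
by apply/pi_eqP/frac_equiv_eq => /=; rewrite scale1r.
Qed.

Lemma locZDr : right_distributive locZ +%R.
Proof.
move=> b; elim/quotW=> x; elim/quotW=> y.
rewrite -[_ + _]/(locD _ _) -[RHS]/(locD _ _) -pi_locD -!pi_locZ -pi_locD.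
by apply/pi_eqP/frac_equiv_eq => /=; rewrite -!mul_mpolyC; ring.
Qed.

Lemma locZDl v : {morph locZ^~ v : b c / b + c}.
Proof.
elim/quotW: v => x b c.
rewrite -[RHS]/(locD _ _) -!pi_locZ -pi_locD.
by apply/pi_eqP/frac_equiv_eq => /=; rewrite -!mul_mpolyC mpolyCD; ring.
Qed.

HB.instance Definition _ :=
  GRing.Zmodule_isLmodule.Build K local_ring locZA loc1Z locZDr locZDl.

Lemma locZAl b (x y : local_ring) : b *: (x * y) = (b *: x) * y.
Proof.
elim/quotW: x => x; elim/quotW: y => y.
rewrite -[LHS]/(locZ b (locM _ _)) -[RHS]/(locM (locZ b _) _).
rewrite -pi_locM -!pi_locZ -pi_locM.
by apply/pi_eqP/frac_equiv_eq => /=; rewrite -!mul_mpolyC; ring.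
Qed.

End LocalRing.

Section Multiplicity.
Variables (K : fieldType) (n m : nat) (q : 'I_m -> {mpoly K[n]}).

Definition zero_of (a : {ffun 'I_n -> K}) : Prop := forall i, (q i).@[a] = 0.

(* [mult_at a e] states that the local ring at [a] has dimension [e] over [K]; *)
(* it fails for every [e] when that dimension is infinite.                     *)
Definition mult_at (a : {ffun 'I_n -> K}) (e : nat) : Prop :=
  inhabited (Vector.axiom e (local_ring q a)).

Definition number_of_zeros (d : nat) : Prop :=
  exists (s : seq {ffun 'I_n -> K}) (e : {ffun 'I_n -> K} -> nat),
    [/\ uniq s, forall a, a \in s <-> zero_of a,
        forall a, a \in s -> mult_at a (e a) & d = (\sum_(a <- s) e a)%N].

End Multiplicity.

Section Genericity.
Variables (k : fieldType) (n : nat).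

Definition in_torus (c : {ffun 'I_n -> k}) : Prop := forall i, c i != 0.

Definition zariski_open (U : {ffun 'I_n -> k} -> Prop) : Prop :=
  exists F : {mpoly k[n]} -> Prop,
    forall c, U c <-> exists2 f, F f & f.@[c] != 0.

Definition generic (P : {ffun 'I_n -> k} -> Prop) : Prop :=
  exists U : {ffun 'I_n -> k} -> Prop,
    [/\ zariski_open U, forall c, U c -> in_torus c, exists c, U c
      & forall c, U c -> P c].

End Genericity.

Section BinomialSystem.
Variables (k : fieldType) (n : nat) (r : 'I_n -> nat) (beta : 'I_n -> 'X_{1..n}).

Definition binomial_poly (c : {ffun 'I_n -> k}) (i : 'I_n) : {mpoly k[n]} :=
  'X_i ^+ r i - c i *: 'X_[beta i].

Definition normal_form : Prop :=
  forall i, [/\ (0 < r i)%N, beta i != 0%MM & (U_(i) *+ r i)%MM != beta i].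

Definition depends_only_on (I : {set 'I_n}) (p : {mpoly k[n]}) : Prop :=
  forall w, w \in msupp p -> forall j, w j != 0%N -> j \in I.

Definition irreducible_system : Prop :=
  normal_form /\
  ~ exists I : {set 'I_n},
      [/\ I != set0, I \proper [set: 'I_n]
        & forall i, i \in I -> forall c, in_torus c ->
            depends_only_on I (binomial_poly c i)].

Definition exponent_mx : 'M[int]_n :=
  \matrix_(i, j) ((r i * (i == j))%:Z - (beta i j)%:Z).

Definition principal_submx (B : 'M[int]_n) (I : {set 'I_n}) : 'M[int]_#|I| :=
  mxsub (fun i => enum_val i) (fun i => enum_val i) B.

Definition global_system : Prop :=
  forall I : {set 'I_n}, I != set0 -> 0 < \det (principal_submx exponent_mx I).

Definition binomial_poly_over (K : fieldType) (iota : {rmorphism k -> K})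
    (c : {ffun 'I_n -> k}) (i : 'I_n) : {mpoly K[n]} :=
  map_mpoly iota (binomial_poly c i).

End BinomialSystem.

(* Main.v *)
Require Import Defs.
From HB Require Import structures.
From mathcomp Require Import all_boot all_order all_algebra.
From mathcomp Require Import fingroup perm separable.
From mathcomp Require Import ssrcomplements mpoly.
From mathcomp Require Import boolp ring lra zify.

Set Implicit Arguments.
Unset Strict Implicit.
Unset Printing Implicit Defensive.

Import Order.TTheory GRing.Theory Num.Theory.
Local Open Scope ring_scope.

(* By irreducibility every zero is the origin or lies in the torus. The torus  *)
(* zeros are simple by the Jacobian criterion, and the Smith normal form of B  *)
(* shows that there are |det B| of them (none for generic c if det B = 0), so  *)
(* d = mu + |det B| and only mu has to be found.                               *)
(*                                                                             *)
(* Modulo the ideal, x_i^(r_i) may be replaced by c_i x^(beta_i): on exponent  *)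
(* vectors this is a chip-firing game, which is abelian, so the final position *)
(* of a terminating game does not depend on the order of the moves. Sending a  *)
(* monomial to its final position, and to 0 if the game never ends, gives a    *)
(* linear map nf from the polynomials onto the span of the box u_i < r_i, of   *)
(* dimension r_1...r_n, which kills the ideal.                                 *)
(*                                                                             *)
(* As B has nonpositive off-diagonal entries, a Schur complement induction     *)
(* gives positive weights w with B w > 0 if all principal minors are positive, *)
(* and otherwise, using irreducibility, positive weights with B w <= 0.        *)
(* In the first case moves decrease the weight, all games end, the kernel of   *)
(* nf is the ideal, and the local ring at the origin is what remains of this   *)
(* r_1...r_n-dimensional algebra once the torus points are split off. In the   *)
(* second case all monomials of large degree have infinite games, so nf        *)
(* factors through the local ring at the origin; by Dickson's lemma an         *)
(* infinite game visits u and then u + t, whence (1 - c^m x^t) x^u = 0, and    *)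
(* x^u vanishes locally as soon as t <> 0 or c^m <> 1. So mu = r_1...r_n.      *)

(** * Ideals and local rings *)

Section Ideal.
Variables (A : comNzRingType) (m : nat) (q : 'I_m -> A).

Lemma in_ideal_gen i : in_ideal q (q i).
Proof.
exists (fun j => (j == i)%:R); rewrite (bigD1 i) //= eqxx mul1r big1 ?addr0 //.
by move=> j /negPf ->; rewrite mul0r.
Qed.

Lemma in_idealMr f h : in_ideal q f -> in_ideal q (f * h).
Proof. by rewrite mulrC; exact: in_idealM. Qed.

Lemma in_idealN f : in_ideal q f -> in_ideal q (- f).
Proof. by rewrite -mulN1r; exact: in_idealM. Qed.

Lemma in_ideal_sum (T : Type) (s : seq T) (P : pred T) (F : T -> A) :
  (forall t, P t -> in_ideal q (F t)) -> in_ideal q (\sum_(t <- s | P t) F t).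
Proof.
by move=> qF; apply: big_ind => //; [exact: in_ideal0 | exact: in_idealD].
Qed.

End Ideal.

Section LocalKernel.
Variables (K : fieldType) (n m : nat) (q : 'I_m -> {mpoly K[n]}).
Variable a : {ffun 'I_n -> K}.

(* The kernel of the localization map from [K[x]] to the local ring at [a]. *)
Definition loc_ker (f : {mpoly K[n]}) : Prop :=
  exists2 u : {mpoly K[n]}, u.@[a] != 0 & in_ideal q (u * f).

Lemma loc_ker_ideal f : in_ideal q f -> loc_ker f.
Proof. by exists 1; rewrite ?meval1 ?oner_neq0 ?mul1r. Qed.

Lemma loc_kerD f g : loc_ker f -> loc_ker g -> loc_ker (f + g).
Proof.
move=> [u ua uf] [v va vg]; exists (u * v); first by rewrite mevalM mulf_neq0.
rewrite (_ : _ * _ = v * (u * f) + u * (v * g)); last by ring.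
by apply: in_idealD; apply: in_idealM.
Qed.

Lemma loc_kerM h f : loc_ker f -> loc_ker (h * f).
Proof. by move=> [u ua uf]; exists u => //; rewrite mulrCA; exact: in_idealM. Qed.

Lemma loc_kerZ c f : loc_ker f -> loc_ker (c *: f).
Proof. by rewrite -mul_mpolyC; exact: loc_kerM. Qed.

Lemma loc_kerB f g : loc_ker f -> loc_ker g -> loc_ker (f - g).
Proof. by move=> fk gk; apply: loc_kerD => //; rewrite -scaleN1r; apply: loc_kerZ. Qed.

Lemma loc_ker_sum (T : Type) (s : seq T) (P : pred T) (F : T -> {mpoly K[n]}) :
  (forall t, P t -> loc_ker (F t)) -> loc_ker (\sum_(t <- s | P t) F t).
Proof.
move=> FN; apply: big_ind => //; last exact: loc_kerD.
exact/loc_ker_ideal/in_ideal0.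
Qed.

Lemma loc_ker_cancel s f : s.@[a] != 0 -> loc_ker (s * f) -> loc_ker f.
Proof.
move=> sa [u ua uf]; exists (u * s); first by rewrite mevalM mulf_neq0.
by rewrite -mulrA.
Qed.

Variables (e : nat) (phi : {linear {mpoly K[n]} -> 'rV[K]_e}).
Hypothesis phi_surj : forall y, exists f, phi f = y.
Hypothesis phi_ker : forall f, phi f = 0 <-> loc_ker f.

(* Multiplication by [s] is injective on the finite-dimensional quotient by    *)
(* the kernel as soon as [s a != 0], hence it is surjective.                   *)
Lemma loc_div s f : s.@[a] != 0 -> exists g, loc_ker (s * g - f).
Proof.
move=> sa.
have [b phi_b] : exists b : 'I_e -> {mpoly K[n]}, forall i, phi (b i) = delta_mx 0 i.
  by have [b bP] := choice (fun i : 'I_e => phi_surj (delta_mx 0 i)); exists b.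
pose sg (y : 'rV[K]_e) := \sum_i y 0 i *: b i.
have sgK y : phi (sg y) = y.
  rewrite linear_sum [RHS]row_sum_delta; apply: eq_bigr => i _.
  by rewrite linearZ /= phi_b.
pose T : 'M[K]_e := \matrix_(i < e) phi (s * b i).
have TE y : y *m T = phi (s * sg y).
  rewrite mulr_sumr linear_sum mulmx_sum_row; apply: eq_bigr => i _.
  by rewrite rowK -scalerAr linearZ.
have Tu : T \in unitmx.
  rewrite -row_free_unit; apply: inj_row_free => y; rewrite TE => /phi_ker.
  by move=> /(loc_ker_cancel sa)/phi_ker; rewrite sgK.
exists (sg (phi f *m invmx T)); apply/phi_ker.
by rewrite linearB /= -TE mulmxKV ?subrr.
Qed.

(** By [loc_div] every fraction equals one with denominator 1, so the polynomials map onto the local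
    ring. The kernel of this map is [loc_ker], that is, the kernel of [phi], which identifies the
    local ring with the row space. *)
Lemma mult_at_of_linear : mult_at q a e.
Proof.
pose piL := \pi_(local_ring q a)%qT.
have rep (x : local_ring q a) : exists g, x = piL (g, denom1 a).
  elim/quotW: x => -[f s].
  have [g [u ua ug]] := loc_div f (valP s).
  exists g; apply/pi_eqP/asboolP; exists u => //=.
  by rewrite mulr1 -opprB mulrN (mulrC g); apply: in_idealN.
have [G GP] := choice rep.
have eqG g h : piL (g, denom1 a) = piL (h, denom1 a) <-> phi g = phi h.
  split=> [/pi_eqP/asboolP[u ua /=]|gh].
    rewrite !mulr1 => ugh; apply/eqP; rewrite -subr_eq0 -linearB; apply/eqP.
    by apply/phi_ker; exists u.
  apply/pi_eqP/asboolP => /=; rewrite !mulr1.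
  have /phi_ker[u ua ugh] : phi (g - h) = 0 by rewrite linearB /= gh subrr.
  by exists u.
have phiG g : phi (G (piL (g, denom1 a))) = phi g by apply/eqG; rewrite -GP.
constructor; exists (fun x => phi (G x)) => [b x y|].
  rewrite -linearP /=.
  transitivity (phi (G (piL (b *: G x + G y, denom1 a)))); last by rewrite phiG.
  congr (phi (G _)); rewrite {1}(GP x) {1}(GP y).
  rewrite -[LHS]/(locD (locZ b _) _) /piL -pi_locZ -pi_locD.
  by apply/pi_eqP/frac_equiv_eq; rewrite /= !mulr1.
have [S SP] := choice phi_surj.
exists (fun y => piL (S y, denom1 a)) => [x|y]; last by rewrite phiG.
by rewrite [RHS]GP; apply/eqG; rewrite SP.
Qed.

End LocalKernel.

Lemma mult_at_of_surjection (K : fieldType) (n m : nat)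
    (q : 'I_m -> {mpoly K[n]}) (a : {ffun 'I_n -> K}) (e : nat)
    (phi : {mpoly K[n]} -> 'rV[K]_e) :
  linear phi -> (forall y, exists f, phi f = y) ->
  (forall f, phi f = 0 <-> loc_ker q a f) -> mult_at q a e.
Proof.
move=> phi_lin phi_surj phi_ker.
pose mix := GRing.isLinear.Build _ _ _ _ phi phi_lin.
pose phiL : {linear {mpoly K[n]} -> 'rV[K]_e} := HB.pack phi mix.
exact: (@mult_at_of_linear _ _ _ _ _ _ phiL).
Qed.

(** * Simple zeros *)

Section SimplePoint.
Variables (K : fieldType) (n : nat) (a : {ffun 'I_n -> K}).

(** The polynomials with this property contain the variables and are closed under products and
    linear combinations. *)
Lemma in_ideal_subr_eval (p : {mpoly K[n]}) :
  in_ideal (fun j => 'X_j - (a j)%:MP) (p - p.@[a]%:MP).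
Proof.
pose I (p : {mpoly K[n]}) := in_ideal (fun j => 'X_j - (a j)%:MP) (p - p.@[a]%:MP).
have IM f g : I f -> I g -> I (f * g).
  move=> If Ig; rewrite /I mevalM mpolyCM.
  rewrite (_ : _ - _ = f * (g - g.@[a]%:MP) + g.@[a]%:MP * (f - f.@[a]%:MP)); last by ring.
  by apply: in_idealD; apply: in_idealM.
have I1 : I 1 by rewrite /I meval1 mpolyC1 subrr; exact: in_ideal0.
have IX j : I 'X_j by rewrite /I mevalXU; exact: in_ideal_gen.
rewrite -/(I p); elim/mpolyind: p => [|c m p _ _ Ip].
  by rewrite /I meval0 mpolyC0 subr0; exact: in_ideal0.
rewrite /I mevalD mevalZ mpolyCD mpolyCM -mul_mpolyC.
rewrite (_ : _ - _ = c%:MP * ('X_[m] - ('X_[m]).@[a]%:MP) + (p - p.@[a]%:MP)); last by ring.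
apply: in_idealD => //; apply: in_idealM; rewrite -/(I _) mpolyXE_id.
apply: big_ind => // j _; elim: (m j) => [|k IHk]; first by rewrite expr0.
by rewrite exprS; apply: IM.
Qed.

Variable q : 'I_n -> {mpoly K[n]}.
Hypothesis q_a : forall i, (q i).@[a] = 0.
Hypothesis jac : \det (\matrix_(i, j) ((q i)^`M(j)).@[a]) != 0.

(* Writing [q i = \sum_j G i j * ('X_j - a j)], Cramer's rule puts             *)
(* [\det G * ('X_j - a j)] in the ideal, and [(\det G) a] is the Jacobian.     *)
Lemma loc_ker_simple f : loc_ker q a f <-> f.@[a] = 0.
Proof.
split=> [[u ua [g ufE]]|fa].
  have : (u * f).@[a] = 0.
    by rewrite ufE raddf_sum big1 //= => i _; rewrite mevalM q_a mulr0.
  by rewrite mevalM => /eqP; rewrite mulf_eq0 (negPf ua) => /eqP.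
have [G GE] := choice (fun i => in_ideal_subr_eval (q i)).
pose M : 'M[{mpoly K[n]}]_n := \matrix_(i, j) G i j.
have qE i : q i = \sum_j M i j * ('X_j - (a j)%:MP).
  have := GE i; rewrite q_a mpolyC0 subr0 => ->.
  by apply: eq_bigr => j _; rewrite mxE.
exists (\det M).
  rewrite -det_map_mx; congr (_ != 0): jac; congr (\det _); apply/matrixP=> i j.
  rewrite !mxE /= qE (linear_sum (mderiv j)) (linear_sum (meval a)) (bigD1 j) //= big1.
    rewrite addr0 mderivM mevalD !mevalM mxE mderivB mderivC subr0 mderivX.
    rewrite mevalB mevalXU mevalC subrr mulr0 add0r mevalZ mnm1E eqxx mul1r.
    have -> : (U_(j) - U_(j) = 0 :> 'X_{1..n})%MM by rewrite -{1}[U_(j)%MM]add0m addmK.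
    by rewrite mpolyX0 meval1 mulr1.
  move=> l lj; rewrite mderivM mevalD !mevalM mderivB mderivC subr0 mderivX.
  rewrite mevalB mevalXU mevalC subrr mulr0 add0r mevalZ mnm1E (negPf lj).
  by rewrite mul0r mulr0.
have := in_ideal_subr_eval f; rewrite fa mpolyC0 subr0 => -[h ->].
rewrite mulr_sumr; apply: in_ideal_sum => j _; rewrite mulrCA; apply: in_idealM.
have -> : \det M * ('X_j - (a j)%:MP) = \sum_i \adj M j i * q i.
  pose X : 'cV[{mpoly K[n]}]_n := \col_j ('X_j - (a j)%:MP).
  have XE l : X l 0 = 'X_l - (a l)%:MP by rewrite mxE.
  transitivity (((\det M)%:M *m X) j 0); first by rewrite mul_scalar_mx [RHS]mxE XE.
  rewrite -mul_adj_mx -mulmxA [LHS]mxE; apply: eq_bigr => i _; congr (_ * _).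
  by rewrite qE [LHS]mxE; apply: eq_bigr => l _; rewrite XE.
by apply: in_ideal_sum => i _; apply/in_idealM/in_ideal_gen.
Qed.

Lemma mult_at_simple : mult_at q a 1.
Proof.
apply: (@mult_at_of_surjection _ _ _ _ _ _ (fun f => (f.@[a])%:M)).
- by move=> b f g; rewrite mevalD mevalZ raddfD scale_scalar_mx.
- move=> y; exists (y 0 0)%:MP; rewrite mevalC.
  by rewrite [RHS]mx11_scalar.
move=> f; rewrite loc_ker_simple; split=> [/matrixP/(_ 0 0)|->].
  by rewrite !mxE.
by rewrite raddf0.
Qed.

End SimplePoint.

(** Multiplying the derivative by the variable restores the exponent; where the subtraction of
    exponents truncates, the coefficient [m j] is 0. *)
Lemma mulX_mderivX (R : comNzRingType) (n : nat) (m : 'X_{1..n}) (j : 'I_n) :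
  'X_j * ('X_[m])^`M(j) = (m j)%:R *: 'X_[m] :> {mpoly R[n]}.
Proof.
rewrite mderivX -scalerAr -mpolyXD.
have [->|mj] := eqVneq (m j) 0%N; first by rewrite !scale0r.
congr (_ *: 'X_[_]); rewrite addmC submK //; rewrite lep1mP //.
Qed.

Lemma intr_eq0_pchar0 (K : fieldType) (z : int) :
  [pchar K] =i pred0 -> (z%:~R == 0 :> K) = (z == 0).
Proof.
move=> /pcharf0P char0; case: z => k; first by rewrite -pmulrn char0.
by rewrite NegzE mulrNz !oppr_eq0 -pmulrn char0.
Qed.

Section TorusPoint.
Variables (K : fieldType) (n : nat) (r : 'I_n -> nat) (beta : 'I_n -> 'X_{1..n}).
Variables (c a : {ffun 'I_n -> K}).

(** At a zero, [c i] times the monomial [beta i] equals [a i ^+ r i], so the Jacobian matrix times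
    diag([a]) is diag([a i ^+ r i]) times the exponent matrix. *)
Lemma jacobian_binomial :
  zero_of (binomial_poly r beta c) a ->
  \det (\matrix_(i, j) ((binomial_poly r beta c i)^`M(j)).@[a]) * \prod_i a i =
  \prod_i (a i ^+ r i) * (\det (exponent_mx r beta))%:~R.
Proof.
move=> za; rewrite -[in RHS]det_map_mx /=.
pose da : 'rV[K]_n := \row_i a i; pose dr : 'rV[K]_n := \row_i (a i ^+ r i).
have -> : \prod_i a i = \det (diag_mx da).
  by rewrite det_diag; apply: eq_bigr => i _; rewrite mxE.
have -> : \prod_i (a i ^+ r i) = \det (diag_mx dr).
  by rewrite det_diag; apply: eq_bigr => i _; rewrite mxE.
rewrite -!det_mulmx; congr (\det _); apply/matrixP=> i j.
rewrite mul_mx_diag mul_diag_mx !mxE.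
rewrite mulrC -{1}[a j](mevalXU a) -mevalM.
rewrite /binomial_poly mderivB mulrBr mderivZ -scalerAr mpolyXn !mulX_mderivX.
have := za i; rewrite /binomial_poly !mevalB !mevalZ mpolyXn => /eqP.
rewrite subr_eq0 => /eqP e1; rewrite mulrCA -e1 -mpolyXn rmorphXn /= mevalXU. 
by rewrite mulmnE mnm1E intrB -!pmulrn -mulrBl mulrC mulnC.
Qed.

Lemma mult_at_torus :
  [pchar K] =i pred0 -> \det (exponent_mx r beta) != 0 ->
  zero_of (binomial_poly r beta c) a -> (forall i, a i != 0) ->
  (forall f, loc_ker (binomial_poly r beta c) a f <-> f.@[a] = 0) /\
  mult_at (binomial_poly r beta c) a 1.
Proof.
move=> char0 detB za a_neq0.
have jac : \det (\matrix_(i, j) ((binomial_poly r beta c i)^`M(j)).@[a]) != 0.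
  have: \prod_i (a i ^+ r i) * (\det (exponent_mx r beta))%:~R != 0 :> K.
    by rewrite mulf_neq0 ?intr_eq0_pchar0 //; apply/prodf_neq0 => i _; apply: expf_neq0.
  by rewrite -jacobian_binomial // mulf_eq0 negb_or => /andP[].
by split; [move=> f; apply: loc_ker_simple | apply: mult_at_simple].
Qed.

End TorusPoint.

(** * Counting the zeros in the torus *)

Lemma card_dffun_ord n (r : 'I_n -> nat) :
  #|{dffun forall i : 'I_n, 'I_(r i)}| = (\prod_(i < n) r i)%N.
Proof.
rewrite card_dep_ffun foldrE big_map -big_enum /=.
by apply: eq_bigr => i _; rewrite card_ord.
Qed.

Lemma enum_box (T : choiceType) n (S : 'I_n -> seq T) :
  (forall i, uniq (S i)) ->
  exists s : seq {ffun 'I_n -> T},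
    [/\ uniq s, forall a, a \in s <-> forall i, a i \in S i
      & size s = (\prod_(i < n) size (S i))%N].
Proof.
move=> S_uniq.
pose F (f : {dffun forall i : 'I_n, 'I_(size (S i))}) : {ffun 'I_n -> T} :=
  [ffun i => tnth (in_tuple (S i)) (f i)].
have F_inj : injective F.
  move=> f g fg; apply/ffunP => i; have := congr1 (fun h : {ffun _} => h i) fg.
  by rewrite !ffunE; apply: (tuple_uniqP (in_tuple (S i)) (S_uniq i)).
exists (map F (enum {: {dffun forall i : 'I_n, 'I_(size (S i))}})); split.
- by rewrite map_inj_uniq ?enum_uniq.
- move=> a; split=> [/mapP[f _ ->] i|aS]; first by rewrite ffunE mem_tnth.
  have idx i : (index (a i) (S i) < size (S i))%N by rewrite index_mem.
  apply/mapP; exists (finfun (fun i => Ordinal (idx i))); first by rewrite mem_enum.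
  by apply/ffunP=> i; rewrite !ffunE (tnth_nth (a i)) /= nth_index.
by rewrite size_map -cardE card_dffun_ord.
Qed.

Section LaurentMonomials.
Variables (K : fieldType).

(** The monomial map between tori with exponent matrix [M]. It is functorial in [M] on torus points
    ([lmonM], [lmon1]), so unimodular matrices act as bijections. *)
Definition lmon n m (M : 'M[int]_(m, n)) (a : {ffun 'I_n -> K}) : {ffun 'I_m -> K} :=
  [ffun i => \prod_j a j ^ M i j].

Lemma expfz_sum (x : K) (I : Type) (s : seq I) (F : I -> int) :
  x != 0 -> x ^ (\sum_(i <- s) F i) = \prod_(i <- s) x ^ F i.
Proof.
by move=> x0; apply: (big_morph (fun z : int => x ^ z)) => [y z|//]; rewrite expfzDr.
Qed.

Lemma expfz_prod (I : Type) (s : seq I) (F : I -> K) (z : int) :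
  (\prod_(i <- s) F i) ^ z = \prod_(i <- s) F i ^ z.
Proof.
apply: (big_morph (fun x : K => x ^ z)) => [x y|]; [exact: expfzMl | exact: exp1rz].
Qed.

Lemma lmon_neq0 n m (M : 'M[int]_(m, n)) (a : {ffun 'I_n -> K}) i :
  (forall j, a j != 0) -> lmon M a i != 0.
Proof. by move=> a0; rewrite ffunE; apply/prodf_neq0 => j _; apply: expfz_neq0. Qed.

Lemma lmonM p n m (M : 'M[int]_(m, n)) (N : 'M[int]_(n, p)) (a : {ffun 'I_p -> K}) :
  (forall j, a j != 0) -> lmon (M *m N) a = lmon M (lmon N a).
Proof.
move=> a0; apply/ffunP => i; rewrite !ffunE.
transitivity (\prod_j \prod_l (a j ^ N l j) ^ M i l).
  apply: eq_bigr => j _; rewrite mxE expfz_sum //; apply: eq_bigr => l _.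
  by rewrite mulrC exprzAC exprz_exp mulrC.
by rewrite exchange_big /=; apply: eq_bigr => l _; rewrite ffunE expfz_prod.
Qed.

Lemma lmon1 n (a : {ffun 'I_n -> K}) : lmon 1%:M a = a.
Proof.
apply/ffunP => i; rewrite ffunE (bigD1 i) //= big1 => [|j ji].
  by rewrite mxE eqxx mulr1 expr1z.
by rewrite mxE eq_sym (negPf ji) expr0z.
Qed.

Lemma lmon0 n m (a : {ffun 'I_n -> K}) : lmon (0 : 'M_(m, n)) a = [ffun=> 1].
Proof. by apply/ffunP => i; rewrite !ffunE big1 // => j _; rewrite mxE expr0z. Qed.

End LaurentMonomials.

Lemma expfz_roots (K : closedFieldType) (d : int) (z : K) :
  [pchar K] =i pred0 -> d != 0 -> z != 0 ->
  exists s : seq K,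
    [/\ uniq s, forall y, y \in s <-> y != 0 /\ y ^ d = z & size s = `|d|%N].
Proof.
move=> char0; wlog [k ->] : d z / exists k, d = Posz k => [hwlog|].
  (* A negative exponent is reduced to a positive one by inverting [z]. *)
  case: d => k d0 z0; first exact: hwlog (ex_intro _ k erefl) d0 z0.
  have [|||s [s_uniq sP ssz]] := hwlog (Posz k.+1) z^-1; rewrite ?invr_eq0 //.
    by exists k.+1.
  exists s; split=> // y; rewrite sP NegzE -invr_expz.
  by split=> -[y0 yz]; split=> //; rewrite ?yz ?invrK // -yz invrK.
rewrite eqz_nat -lt0n => k0 z0.
have p_monic : 'X^k - z%:P \is monic by rewrite monicXnsubC.
have [s sE] := closed_field_poly_normal ('X^k - z%:P).
rewrite (monicP p_monic) scale1r in sE.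
have kK : k%:R != 0 :> K by rewrite ((pcharf0P _).1 char0) -lt0n.
exists s; split.
- rewrite -separable_prod_XsubC -sE unlock; apply/Bezout_coprimepP.
  (* The Bezout relation between X^k - z and its derivative: -(X^k - z)/z + (X/(kz)) k X^(k-1) =
     1. *)
  exists (- z^-1%:P, (k%:R * z)^-1 *: 'X).
  rewrite derivB derivC subr0 derivXn /=.
  have -> : (k%:R * z)^-1 *: 'X * ('X^(k.-1) *+ k) = z^-1 *: 'X^k :> {poly K}.
    rewrite mulrnAr -scalerAl -exprS prednK // -scaler_nat scalerA invfM mulrA.
    by rewrite mulfV // mul1r.
  rewrite mulrBr mulNr mulNr opprK -polyCM mulVf // -mul_polyC addrAC addNr add0r.
  exact: eqpxx.
- move=> y; have: (y \in s) = root ('X^k - z%:P) y by rewrite sE root_prod_XsubC.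
  rewrite rootE !hornerE subr_eq0 => ->; split=> [/eqP yk|[_]].
    split=> //; apply: contraNneq z0 => y0; rewrite -yk y0 expr0n.
    by rewrite -leqn0 leqNgt k0.
  by rewrite -exprnP => ->.
have := congr1 (fun p : {poly K} => size p) sE.
by rewrite size_prod_XsubC size_XnsubC // => -[].
Qed.

Section TorusCount.
Variables (n : nat) (r : 'I_n -> nat) (beta : 'I_n -> 'X_{1..n}).

Lemma zero_of_torus (K : fieldType) (c a : {ffun 'I_n -> K}) :
  (forall i, a i != 0) ->
  zero_of (binomial_poly r beta c) a <-> lmon (exponent_mx r beta) a = c.
Proof.
move=> a0.
have lE i : lmon (exponent_mx r beta) a i = a i ^+ r i / ('X_[beta i]).@[a].
  rewrite mevalX ffunE -prodfV [X in _ = X * _](_ : _ = \prod_j a j ^+ (r i * (i == j))).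
    rewrite -big_split /=; apply: eq_bigr => j _.
    by rewrite mxE expfzDr // -invr_expz -!exprnP.
  rewrite (bigD1 i) //= eqxx muln1 big1 ?mulr1 // => j ji.
  by rewrite eq_sym (negPf ji) muln0 expr0.
have b0 i : ('X_[beta i]).@[a] != 0.
  by rewrite mevalX; apply/prodf_neq0 => j _; apply: expf_neq0.
have pE i : (binomial_poly r beta c i).@[a] = a i ^+ r i - c i * ('X_[beta i]).@[a].
  by rewrite /binomial_poly mevalB mevalZ rmorphXn /= mevalXU.
split=> [za|ac i].
  apply/ffunP=> i; rewrite lE.
  by have /eqP := za i; rewrite pE subr_eq0 => /eqP ->; rewrite mulfK.
by rewrite pE -[in c i]ac lE divfK // subrr.
Qed.

(** For [l] in the left kernel of B, a torus zero satisfies c^l = a^(lB) = 1. Hence torus zeros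
    exist only for special [c]. *)
Lemma torus_zeros_singular :
  \det (exponent_mx r beta) = 0 ->
  exists2 l : 'rV[int]_n, l != 0 &
    forall (K : fieldType) (c a : {ffun 'I_n -> K}), (forall i, a i != 0) ->
      zero_of (binomial_poly r beta c) a -> \prod_i c i ^ l 0 i = 1.
Proof.
move=> /eqP/det0P[l l0 lB]; exists l => // K c a a0 /(zero_of_torus _ a0) <-.
have := congr1 (fun f : {ffun _ -> _} => f 0) (lmonM l (exponent_mx r beta) a0).
by rewrite lB lmon0 !ffunE.
Qed.

(** With the Smith form B = L D R, the system a^B = c becomes, in the torus coordinates y = a^R, the
    uncoupled system y^D = c^(L^-1). Its i-th equation has [|d_i|] roots, and the product of these
    numbers is [|det B|]. *)
Lemma torus_zeros (K : closedFieldType) (c : {ffun 'I_n -> K}) :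
  [pchar K] =i pred0 -> \det (exponent_mx r beta) != 0 -> (forall i, c i != 0) ->
  exists s : seq {ffun 'I_n -> K},
    [/\ uniq s,
        forall a, a \in s <-> zero_of (binomial_poly r beta c) a /\ forall i, a i != 0
      & size s = `|\det (exponent_mx r beta)|%N].
Proof.
move=> char0 detB c0; set B := exponent_mx r beta in detB *.
have [L Lu [R Ru [d _ BE]]] := int_Smith_normal_form B.
set D := \matrix_(i, j) _ in BE.
have detD : \det D = \prod_(i < n) d`_i.
  have -> : D = diag_mx (\row_i d`_i) by apply/matrixP => i j; rewrite !mxE.
  by rewrite det_diag; apply: eq_bigr => i _; rewrite mxE.
have absdet (M : 'M[int]_n) : M \in unitmx -> `|\det M|%N = 1%N.
  by rewrite unitmxE => /orP[]/eqP ->.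
have BD : `|\det B|%N = (\prod_(i < n) `|(d`_i)%R|)%N.
  rewrite BE !det_mulmx !abszM (absdet L) ?(absdet R) // mul1n muln1 detD.
  by apply: (big_morph absz) => // x y; rewrite abszM.
have d0 (i : 'I_n) : d`_i != 0.
  have: (0 < \prod_(i < n) `|(d`_i)%R|)%N by rewrite -BD absz_gt0.
  by rewrite (bigD1 i) //= muln_gt0 absz_gt0 => /andP[].
pose c' := lmon (invmx L) c.
have c'0 i : c' i != 0 by apply: lmon_neq0.
have [S SP] := choice (fun i => expfz_roots char0 (d0 i) (c'0 i)).
have [|s [s_uniq sP ssz]] := @enum_box K n S; first by move=> i; case: (SP i).
have lmonD y i : lmon D y i = y i ^ d`_i :> K.
  rewrite ffunE (bigD1 i) //= big1 ?mulr1 => [|j ji]; first by rewrite mxE eqxx.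
  by rewrite mxE val_eqE eq_sym (negPf ji) expr0z.
have s0 y i : y \in s -> y i != 0 by move=> /sP/(_ i); case: (SP i) => _ -> _ [].
have sD (y : {ffun 'I_n -> K}) : (forall i, y i != 0) -> y \in s <-> lmon D y = c'.
  move=> y0; rewrite sP; split=> [yS|yD i].
    by apply/ffunP=> i; rewrite lmonD; case: (SP i) (yS i) => _ -> _ [].
  by case: (SP i) => _ -> _; rewrite -lmonD yD.
have RK (y : {ffun 'I_n -> K}) : (forall i, y i != 0) -> lmon R (lmon (invmx R) y) = y.
  by move=> y0; rewrite -lmonM // mulmxV // lmon1.
have RVK (y : {ffun 'I_n -> K}) : (forall i, y i != 0) -> lmon (invmx R) (lmon R y) = y.
  by move=> y0; rewrite -lmonM // mulVmx // lmon1.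
have zE (a : {ffun 'I_n -> K}) : (forall i, a i != 0) ->
    zero_of (binomial_poly r beta c) a <-> lmon R a \in s.
  move=> a0; have Ra0 i : lmon R a i != 0 by apply: lmon_neq0.
  have DRa0 i : lmon D (lmon R a) i != 0 by apply: lmon_neq0.
  rewrite zero_of_torus // -/B BE !lmonM // sD // /c'; split=> [<-|->].
    by rewrite -(lmonM (invmx L) L) // mulVmx // lmon1.
  by rewrite -(lmonM L (invmx L)) // mulmxV // lmon1.
exists (map (lmon (invmx R)) s); split.
- rewrite map_inj_in_uniq // => y z ys zs yz.
  have [y0 z0] : (forall i, y i != 0) /\ forall i, z i != 0 by split=> i; apply: s0.
  by rewrite -(RK y) // yz RK.
- move=> a; split=> [/mapP[y ys ->]|[za a0]].
    have y0 i : y i != 0 by apply: s0.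
    have Ry0 i : lmon (invmx R) y i != 0 by apply: lmon_neq0.
    by split=> //; apply/zE; rewrite ?RK.
  apply/mapP; exists (lmon R a); first exact/zE.
  by rewrite RVK.
rewrite size_map ssz BD; apply: eq_bigr => i _.
by case: (SP i).
Qed.

End TorusCount.

(** * Matrices with nonpositive off-diagonal entries *)

Section ZMatrix.
Variable F : realFieldType.

Definition Zmx n (B : 'M[F]_n) := forall i j, i != j -> B i j <= 0.
Definition posv n (w : 'cV[F]_n) := forall i, 0 < w i 0.
Definition nnegv n (w : 'cV[F]_n) := forall i, 0 <= w i 0.

Lemma Zmx_drsubmx n (B : 'M[F]_(1 + n)) : Zmx B -> Zmx (drsubmx B).
Proof. by move=> ZB i j ij; rewrite !mxE; apply: ZB; rewrite (inj_eq (@rshift_inj _ _)). Qed.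

Lemma nneg_mul_Zrow n (B : 'M[F]_(1 + n)) (w : 'cV[F]_n) :
  Zmx B -> nnegv w -> (ursubmx B *m w) 0 0 <= 0.
Proof.
move=> ZB w0; rewrite mxE sumr_le0 // => j _; rewrite mulr_le0_ge0 // !mxE.
by apply: ZB; rewrite eq_lrshift.
Qed.

Lemma Zcol_le0 n (B : 'M[F]_(1 + n)) i : Zmx B -> (dlsubmx B) i 0 <= 0.
Proof. by move=> ZB; rewrite !mxE; apply: ZB; rewrite eq_rlshift. Qed.

Lemma forall_col_mx n (P : F -> Prop) (u : 'cV[F]_1) (v : 'cV[F]_n) :
  P (u 0 0) -> (forall i, P (v i 0)) -> forall i, P (col_mx u v i 0).
Proof.
move=> Pu Pv i; rewrite -(splitK i); case: (split i) => j /=.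
  by rewrite col_mxEu (ord1 j).
by rewrite col_mxEd.
Qed.

(** Let t be the least ratio y_i / w_i, reached at i. If t < 0, then z = y - t w is nonnegative with
    z_i = 0, so (B z)_i <= 0 by the signs of B; but B z = B y - t B w is positive. *)
Lemma Mmx_mono n (B : 'M[F]_n) (w y : 'cV[F]_n) :
  Zmx B -> posv w -> posv (B *m w) -> nnegv (B *m y) -> nnegv y.
Proof.
move=> ZB w0 Bw0 By0 i0; pose t i := y i 0 / w i 0.
have [/= i _ tmin] := @arg_minP _ _ _ i0 xpredT t isT.
suff t0 : 0 <= t i.
  rewrite -[y i0 0](divfK (lt0r_neq0 (w0 i0))) mulr_ge0 ?(ltW (w0 _)) //.
  exact: le_trans t0 (tmin _ isT).
rewrite leNgt; apply/negP => tn.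
pose z := y - t i *: w.
have z0 j : 0 <= z j 0.
  by rewrite !mxE subr_ge0 -ler_pdivlMr ?w0 // tmin.
have zi : z i 0 = 0 by rewrite !mxE divfK ?subrr // lt0r_neq0.
have : (B *m z) i 0 <= 0.
  rewrite mxE (bigD1 i) //= zi mulr0 add0r sumr_le0 // => j ji.
  by rewrite mulr_le0_ge0 // ZB // eq_sym.
apply/negP; rewrite -ltNge /z mulmxBr -scalemxAr.
move: (By0 i) (Bw0 i); move: (B *m y) (B *m w) => u v u0 v0.
by rewrite !mxE -mulNr ltr_wpDl // mulr_gt0 ?oppr_gt0.
Qed.

Lemma Mmx_unit n (B : 'M[F]_n) (w : 'cV[F]_n) :
  Zmx B -> posv w -> posv (B *m w) -> B \in unitmx.
Proof.
move=> ZB w0 Bw0; rewrite -unitmx_tr -row_free_unit; apply: inj_row_free => v vB.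
have Bv : B *m v^T = 0 by rewrite -[B]trmxK -trmx_mul vB trmx0.
apply/rowP => i; apply/eqP; rewrite mxE eq_le; apply/andP; split.
  rewrite -oppr_ge0.
  have := @Mmx_mono _ _ _ (- v^T) ZB w0 Bw0 _ i; rewrite mulmxN Bv oppr0 !mxE.
  by apply=> j; rewrite mxE.
by have := @Mmx_mono _ _ _ (v^T) ZB w0 Bw0 _ i; rewrite Bv !mxE; apply=> j; rewrite mxE.
Qed.

Section Schur.
Variables (n : nat) (B : 'M[F]_(1 + n)).
Hypothesis B'u : drsubmx B \in unitmx.

(** [schur] is the Schur complement of the lower right block, and [schur_col] completes 1 to a
    vector that B maps to ([schur], 0). *)
Definition schur_col : 'cV[F]_n := - (invmx (drsubmx B) *m dlsubmx B).
Definition schur : F := (ulsubmx B + ursubmx B *m schur_col) 0 0.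

Lemma mul_schur_col : drsubmx B *m schur_col = - dlsubmx B.
Proof. by rewrite mulmxN mulKVmx. Qed.

Lemma mul_schur : B *m col_mx 1 schur_col = col_mx schur%:M 0.
Proof.
rewrite -[B in LHS]submxK mul_block_col mul_schur_col !mulmx1 subrr.
by rewrite [X in col_mx X]mx11_scalar.
Qed.

Lemma det_schur : \det B = schur * \det (drsubmx B).
Proof.
have : \det (B *m block_mx 1 0 schur_col 1) = schur * \det (drsubmx B).
  rewrite -[B in LHS]submxK mulmx_block mul_schur_col !mulmx1 subrr !mulmx0 !add0r.
  by rewrite det_ublock [X in \det X]mx11_scalar det_scalar1.
by rewrite det_mulmx det_lblock !det1 !mulr1.
Qed.

Lemma schur_col_ge0 (w : 'cV[F]_n) :
  Zmx B -> posv w -> posv (drsubmx B *m w) -> nnegv schur_col.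
Proof.
move=> ZB w0 Bw0; apply: Mmx_mono (Zmx_drsubmx ZB) w0 Bw0 _ => i.
by rewrite mul_schur_col mxE oppr_ge0; apply: Zcol_le0.
Qed.

End Schur.

(** Induction through [det_schur]. By monotonicity of the lower right block, w' >= w1 [schur_col],
    and the first row is nonpositive off the diagonal, so 0 < (B w)_1 <= w1 [schur]. *)
Lemma Mmx_det n (B : 'M[F]_n) (w : 'cV[F]_n) :
  Zmx B -> posv w -> posv (B *m w) -> 0 < \det B.
Proof.
elim: n => [|n IHn] in B w *; first by rewrite det_mx00.
move: B w; change n.+1 with (1 + n)%N => B w ZB w0 Bw0.
pose w' := dsubmx w; pose w1 := w (lshift n 0) 0.
have w10 : 0 < w1 by apply: w0.
have w'0 : posv w' by move=> i; rewrite mxE.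
have wE : w = col_mx w1%:M w' by rewrite -[LHS]vsubmxK [usubmx w]mx11_scalar !mxE.
have BwE : B *m w = col_mx (ulsubmx B *m w1%:M + ursubmx B *m w')
                           (dlsubmx B *m w1%:M + drsubmx B *m w').
  by rewrite -[B in LHS]submxK wE mul_block_col.
have B'w'E : drsubmx B *m w' = dsubmx (B *m w) - w1 *: dlsubmx B.
  by rewrite BwE col_mxKd mul_mx_scalar addrAC subrr add0r.
have B'w' : posv (drsubmx B *m w').
  move=> i; rewrite B'w'E; move: (Bw0 (rshift 1 i)) (Zcol_le0 i ZB).
  move: (B *m w) (dlsubmx B) => u v u0 v0.
  by rewrite !mxE -mulrN ltr_pwDl // mulr_ge0 ?(ltW w10) // oppr_ge0.
have ZB' := Zmx_drsubmx ZB.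
have B'u := Mmx_unit ZB' w'0 B'w'.
rewrite det_schur // mulr_gt0 ?(IHn _ w') //.
pose z := w' - w1 *: schur_col B.
have z0 : nnegv z.
  apply: Mmx_mono ZB' w'0 B'w' _ => i.
  rewrite mulmxBr -scalemxAr mul_schur_col // B'w'E scalerN opprK subrK mxE.
  exact/ltW/Bw0.
have := nneg_mul_Zrow ZB z0.
have : 0 < usubmx (B *m w) 0 0 by rewrite mxE.
rewrite BwE col_mxKu mulmxBr -scalemxAr mul_mx_scalar /schur.
rewrite !mxE => h1 h2; rewrite -(pmulr_rgt0 _ w10); lra.
Qed.

(** Induction on the lower right block B'. In the second alternative a witness for B' is extended by
    0. In the first, the sign of the Schur complement decides: if it is nonpositive, (1,
    [schur_col]) and B itself are witnesses; if positive, (1, [schur_col]) is perturbed by a small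
    multiple of (0, w). *)
Lemma Zmx_dichotomy n (B : 'M[F]_n) : Zmx B ->
  (exists2 w : 'cV[F]_n, posv w & posv (B *m w)) \/
  ((exists w : 'cV[F]_n, [/\ nnegv w, w != 0 & nnegv (- (B *m w))]) /\
   exists m (f : 'I_m -> 'I_n), injective f /\ \det (mxsub f f B) <= 0).
Proof.
elim: n => [|n IHn] in B *; first by left; exists 0 => -[].
move: B; change n.+1 with (1 + n)%N => B ZB.
have ZB' := Zmx_drsubmx ZB.
have [[w w0 Bw0]|[[w [w0 wn0 Bw0]] [m [f [f_inj det_f]]]]] := IHn _ ZB'; last first.
  right; split; last first.
    exists m, (fun i => rshift 1 (f i)); split; first by move=> i j /(@rshift_inj 1 n)/f_inj.
    by congr (\det _ <= 0): det_f; apply/matrixP=> i j; rewrite !mxE.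
  exists (col_mx 0 w); split.
  - by apply: (forall_col_mx (P := fun x => 0 <= x)) => //; rewrite mxE.
  - apply: contraNneq wn0 => /(congr1 dsubmx); rewrite col_mxKd => ->.
    by rewrite linear0.
  rewrite -[B]submxK mul_block_col !mulmx0 !add0r opp_col_mx.
  apply: (forall_col_mx (P := fun x => 0 <= x)) => //.
  by rewrite mxE oppr_ge0; apply: nneg_mul_Zrow.
have B'u := Mmx_unit ZB' w0 Bw0.
have y0 := schur_col_ge0 B'u ZB w0 Bw0.
have [s0|s0] := lerP (schur B) 0.
  right; split.
    exists (col_mx 1 (schur_col B)); split.
    - by apply: (forall_col_mx (P := fun x => 0 <= x)) => //; rewrite mxE eqxx.
    - apply/eqP => /(congr1 usubmx); rewrite col_mxKu linear0 => /matrixP/(_ 0 0)/eqP.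
      by rewrite !mxE oner_eq0.
    rewrite mul_schur // opp_col_mx; apply: (forall_col_mx (P := fun x => 0 <= x)) => [|i].
      by rewrite !mxE eqxx oppr_ge0.
    by rewrite !mxE oppr0.
  exists (1 + n)%N, id; split=> //; rewrite mxsub_id det_schur //.
  by rewrite mulr_le0_ge0 // ltW // (Mmx_det ZB' w0).
left; pose t := - (ursubmx B *m w) 0 0.
have t0 : 0 <= t.
  by rewrite /t oppr_ge0; apply: nneg_mul_Zrow => // i; exact/ltW/w0.
have t10 : 0 < t + 1 by rewrite ltr_wpDl.
(* With this choice the first entry of the image is [schur B - eps * t = eps]. *)
pose eps := schur B / (t + 1).
have eps0 : 0 < eps by rewrite divr_gt0.
exists (col_mx 1 (schur_col B + eps *: w)).
  apply: (forall_col_mx (P := fun x => 0 < x)) => [|i]; first by rewrite mxE eqxx.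
  move: (y0 i) (w0 i); move: (schur_col B) => y yi wi; rewrite !mxE.
  exact/ltr_wpDl/mulr_gt0.
have -> : col_mx 1 (schur_col B + eps *: w) = col_mx 1 (schur_col B) + eps *: col_mx 0 w.
  by rewrite scale_col_mx add_col_mx scaler0 addr0.
rewrite mulmxDr -scalemxAr mul_schur // -[B in B *m _]submxK mul_block_col !mulmx0 !add0r.
rewrite scale_col_mx add_col_mx add0r; apply: (forall_col_mx (P := fun x => 0 < x)) => [|i].
  rewrite 2!mxE eqxx mulr1n mxE.
  have -> : schur B = eps * (t + 1) by rewrite divfK // gt_eqF.
  by rewrite -[(ursubmx B *m w) 0 0]opprK -/t mulrN mulrDr mulr1 addrAC subrr add0r.
by rewrite mxE mulr_gt0.
Qed.

End ZMatrix.

(** * Positive weights for the exponent matrix *)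

(** In the graph with an edge from i to j whenever [beta i j] is nonzero, a set without outgoing
    edges would be a closed subsystem. *)
Lemma irreducible_exit (k : fieldType) n (r : 'I_n -> nat) (beta : 'I_n -> 'X_{1..n})
    (I : {set 'I_n}) :
  irreducible_system k r beta -> I != set0 -> I \proper [set: 'I_n] ->
  exists2 i, i \in I & exists2 j, j \notin I & beta i j != 0%N.
Proof.
move=> [_ irr] I0 Ip; apply: contrapT => no_exit; apply: irr; exists I; split=> // i iI c _.
have betaI j : beta i j != 0%N -> j \in I.
  move=> bj; apply: contrapT => /negP jI; apply: no_exit.
  by exists i => //; exists j.
move=> w /msuppB_le; rewrite mem_cat mpolyXn => /orP[|/msuppZ_le] /mem_msuppXP <- j.
  by rewrite mulmnE mnm1E; case: (eqVneq i j) => [<-|_].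
exact: betaI.
Qed.

Lemma clear_denominators n (w : 'I_n -> rat) : (forall i, 0 < w i) ->
  exists2 N : nat, (0 < N)%N &
    exists W : 'I_n -> nat, forall i, (W i)%:R = N%:R * w i.
Proof.
move=> w0; exists (\prod_i `|denq (w i)|)%N.
  by rewrite prodn_gt0 // => i; rewrite absz_gt0 denq_neq0.
exists (fun i => (`|numq (w i)| * \prod_(j | j != i) `|denq (w j)|)%N) => i.
rewrite [in RHS](bigD1 i) //= !natrM mulrAC; congr (_ * _).
rewrite mulrC -[X in _ = X * _](divq_num_den (w i)).
have absE (z : int) : 0 <= z -> `|z|%N%:R = z%:~R :> rat.
  by move=> z0; rewrite -[in RHS](gez0_abs z0) -pmulrn.
rewrite !absE ?denq_ge0 ?numq_ge0 ?(ltW (w0 i)) //.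
by rewrite divfK // intr_eq0 denq_neq0.
Qed.

(** Rows and columns undergo the same permutation, so the two signs cancel. This passes from an
    injection to the enumeration of its image used in [principal_submx]. *)
Lemma det_mxsub_same_image (R : comNzRingType) n m p (B : 'M[R]_n)
    (f : 'I_m -> 'I_n) (g : 'I_p -> 'I_n) :
  m = p -> injective f -> (forall i, exists j, f i = g j) ->
  \det (mxsub f f B) = \det (mxsub g g B).
Proof.
move=> mp; subst p => f_inj fg; have [s sE] := choice fg.
have s_inj : injective s by move=> i j sij; apply: f_inj; rewrite !sE sij.
pose S := perm s_inj.
have -> : mxsub f f B = perm_mx S *m mxsub g g B *m perm_mx S^-1.
  by rewrite -row_permE -col_permE; apply/matrixP => i j; rewrite !mxE !permE !sE.
by rewrite !det_mulmx !det_perm odd_permV mulrAC -signr_addb addbb mul1r.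
Qed.

Section Weights.
Variables (k : fieldType) (n : nat) (r : 'I_n -> nat) (beta : 'I_n -> 'X_{1..n}).
Hypothesis irr : irreducible_system k r beta.

Let B : 'M[rat]_n := map_mx intr (exponent_mx r beta).

Lemma exponent_ZmxQ : Zmx B.
Proof.
move=> i j ij; rewrite !mxE (negPf ij) muln0 sub0r.
by rewrite mulrNz oppr_le0 -pmulrn ler0n.
Qed.

Lemma mul_exponent_mxQ (w : 'cV[rat]_n) (i : 'I_n) :
  (B *m w) i 0 = (r i)%:R * w i 0 - \sum_j (beta i j)%:R * w j 0.
Proof.
rewrite mxE.
have -> : (r i)%:R * w i 0 = \sum_j (r i * (i == j))%:R * w j 0 :> rat.
  rewrite (bigD1 i) //= eqxx muln1 big1 ?addr0 // => j ji.
  by rewrite eq_sym (negPf ji) muln0 mul0r.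
rewrite -sumrB; apply: eq_bigr => j _.
by rewrite !mxE intrB -!pmulrn mulrBl.
Qed.

Lemma natural_weight (w : 'cV[rat]_n) : posv w ->
  exists2 W : 'I_n -> nat, (forall i, (0 < W i)%N) &
   exists2 N : nat, (0 < N)%N & forall i,
    N%:R * (B *m w) i 0 = (r i * W i)%:R - (\sum_j beta i j * W j)%N%:R.
Proof.
move=> w0; have [N N0 [W WE]] := clear_denominators w0.
exists W => [i|]; first by rewrite -(ltr_nat rat) WE mulr_gt0 ?ltr0n.
exists N => // i; rewrite mul_exponent_mxQ mulrBr natrM WE mulrCA; congr (_ - _).
rewrite mulr_sumr natr_sum; apply: eq_bigr => j _.
by rewrite natrM WE mulrCA.
Qed.

Lemma det_principal (I : {set 'I_n}) :
  (\det (principal_submx (exponent_mx r beta) I))%:~R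
    = \det (mxsub (fun i : 'I_#|I| => enum_val i) (fun i => enum_val i) B).
Proof. by rewrite -det_map_mx map_mxsub. Qed.

(** Restricting [w] to I drops only nonpositive terms from B w, so [Mmx_det] applies to each
    principal submatrix. *)
Lemma pos_weight_minors (w : 'cV[rat]_n) :
  posv w -> posv (B *m w) -> global_system r beta.
Proof.
move=> w0 Bw0 I _; rewrite -(ltr0z rat) det_principal.
have ZB := exponent_ZmxQ.
apply: (@Mmx_det _ _ _ (\col_i w (enum_val i) 0)) => [i j ij|i|i].
- by rewrite mxE; apply: ZB; rewrite (inj_eq enum_val_inj).
- by rewrite mxE.
rewrite mxE; under eq_bigr => j _ do rewrite [_ j 0]mxE mxE.
rewrite -(big_enum_val (fun j => B (enum_val i) j * w j 0)) /=.
apply: lt_le_trans (Bw0 (enum_val i)) _.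
rewrite mxE (bigID (mem I)) /= gerDl sumr_le0 // => j jI.
rewrite mulr_le0_ge0 ?(ltW (w0 j)) // ZB //.
by apply: contraNneq jI => <-; apply: enum_valP.
Qed.

Lemma global_minors m (f : 'I_m -> 'I_n) :
  global_system r beta -> injective f -> 0 < \det (mxsub f f B).
Proof.
(* [global_system] speaks of nonempty sets; the empty minor is 1. *)
case: m f => [|m] f gl f_inj; first by rewrite det_mx00.
pose I := f @: [set: 'I_m.+1].
have fI i : f i \in I by apply: imset_f; rewrite inE.
rewrite (@det_mxsub_same_image _ _ _ _ _ f (fun i : 'I_#|I| => enum_val i)) //.
- rewrite -det_principal ltr0z; apply: gl.
  by apply/set0Pn; exists (f 0).
- by rewrite card_imset // cardsT card_ord.
by move=> i; exists (enum_rank_in (fI i) (f i)); rewrite enum_rankK_in.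
Qed.

Lemma global_det_gt0 : global_system r beta -> 0 < \det (exponent_mx r beta).
Proof.
move=> gl; rewrite -(ltr0z rat) -det_map_mx -[map_mx _ _]mxsub_id.
exact: global_minors.
Qed.

Lemma global_weight : global_system r beta ->
  exists2 w : 'I_n -> nat, (forall i, (0 < w i)%N) &
    forall i, (\sum_j beta i j * w j < r i * w i)%N.
Proof.
move=> gl; have [[w w0 Bw0]|[_ [m [f [f_inj]]]]] := Zmx_dichotomy exponent_ZmxQ; last first.
  by rewrite leNgt global_minors.
have [W W0 [N N0 WE]] := natural_weight w0.
exists W => // i; rewrite -(ltr_nat rat) -subr_gt0 -WE.
by rewrite mulr_gt0 ?ltr0n.
Qed.

(* If [w i = 0] while [beta i j] and [w j] are nonzero, then [(B w) i < 0], so *)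
(* [w i] can be raised slightly; irreducibility provides such a pair [i, j]    *)
(* as long as [w] has a zero entry.                                            *)
Lemma spread_support (w : 'cV[rat]_n) :
  nnegv w -> w != 0 -> nnegv (- (B *m w)) ->
  exists2 w' : 'cV[rat]_n, posv w' & nnegv (- (B *m w')).
Proof.
have [m] := ubnP #|[set i | w i 0 == 0]|; elim: m w => // m IHm w le_m w0 wn0 Bw0.
set Z := [set i | w i 0 == 0] in le_m.
have [Z0|Z0] := eqVneq Z set0.
  exists w => // i; rewrite lt_def w0 andbT.
  by have := in_set0 i; rewrite -Z0 inE => ->.
have Zp : Z \proper [set: 'I_n].
  rewrite properT; apply: contraNneq wn0 => ZT; apply/eqP/colP => i.
  by have := in_setT i; rewrite -ZT inE mxE => /eqP ->.
have [i iZ [j jZ bij]] := irreducible_exit irr Z0 Zp.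
have wi : w i 0 = 0 by apply/eqP; rewrite inE in iZ.
have wj : 0 < w j 0 by rewrite lt_def w0 andbT; rewrite inE in jZ.
have Bwi : (B *m w) i 0 < 0.
  rewrite mul_exponent_mxQ wi mulr0 sub0r oppr_lt0 (bigD1 j) //=.
  rewrite ltr_pwDl ?mulr_gt0 ?ltr0n ?lt0n // sumr_ge0 // => l _.
  by rewrite mulr_ge0 ?ler0n.
have den0 : 0 < `|B i i| + 1 by rewrite ltr_wpDl.
(* Raising [w i] by this [eps] changes (B w)_i to at most -[eps], and can only lower the other
   entries of B w. *)
have [eps eps0 epsE] : exists2 eps, 0 < eps & eps * (`|B i i| + 1) = - (B *m w) i 0.
  exists (- (B *m w) i 0 / (`|B i i| + 1)); first by rewrite divr_gt0 ?oppr_gt0.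
  by rewrite divfK // gt_eqF.
have w'E l : (w + eps *: delta_mx i 0) l 0 = w l 0 + eps * (l == i)%:R.
  by rewrite !mxE eqxx andbT.
apply: (IHm (w + eps *: delta_mx i 0)).
- rewrite -ltnS; apply: leq_trans le_m; apply: proper_card; apply/properP; split.
    apply/subsetP => l; rewrite !inE w'E paddr_eq0 ?w0 ?mulr_ge0 ?ler0n ?(ltW eps0) //.
    by case/andP.
  exists i => //; rewrite inE w'E wi add0r eqxx mulr1.
  by rewrite gt_eqF.
- by move=> l; rewrite w'E addr_ge0 ?w0 // mulr_ge0 ?ler0n ?(ltW eps0).
- apply/eqP => /(congr1 (fun M : 'cV_n => M i 0))/eqP; rewrite w'E wi add0r eqxx mulr1 mxE.
  by rewrite gt_eqF.
have ZB := exponent_ZmxQ.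
have negE (v : 'cV[rat]_n) l : (- v) l 0 = - v l 0 by rewrite mxE.
have Bw'E l : (B *m (w + eps *: delta_mx i 0)) l 0 = (B *m w) l 0 + eps * B l i.
  by rewrite mulmxDr -scalemxAr -colE; move: (B *m w) B => u C; rewrite !mxE.
move=> l; have := Bw0 l; rewrite !negE Bw'E !oppr_ge0 => Bwl.
have [->|li] := eqVneq l i; last first.
  by apply: le_trans Bwl; rewrite gerDl mulr_ge0_le0 ?(ltW eps0) // ZB.
rewrite -[(B *m w) i 0]opprK -epsE.
rewrite addrC subr_le0 ler_wpM2l ?(ltW eps0) //.
by rewrite (le_trans (ler_norm _)) // lerDl.
Qed.

Lemma local_weight : ~ global_system r beta ->
  exists2 w : 'I_n -> nat, (forall i, (0 < w i)%N) &
    forall i, (r i * w i <= \sum_j beta i j * w j)%N.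
Proof.
move=> ngl; have [[w w0 Bw0]|[[w [w0 wn0 Bw0]] _]] := Zmx_dichotomy exponent_ZmxQ.
  by case: ngl; apply: pos_weight_minors w0 Bw0.
have [w' w'0 Bw'0] := spread_support w0 wn0 Bw0.
have [W W0 [N N0 WE]] := natural_weight w'0.
exists W => // i; rewrite -(ler_nat rat) -subr_le0 -WE.
rewrite mulr_ge0_le0 ?ler0n //.
by have := Bw'0 i; rewrite mxE oppr_ge0.
Qed.

End Weights.

(** * Chip firing *)

(** Each index is chosen to minimize [f] on the tail beyond the previous one. *)
Lemma nondecreasing_subseq (f : nat -> nat) :
  exists2 g : nat -> nat, {homo g : a b / (a < b)%N} &
    {homo f \o g : a b / (a <= b)%N}.
Proof.
have tail_min k : exists m, (k <= m)%N /\ forall l, (k <= l)%N -> (f m <= f l)%N.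
  have ex_v : exists v, `[< exists2 m, (k <= m)%N & f m = v >].
    by exists (f k); apply/asboolP; exists k.
  case: (ex_minnP ex_v) => _ /asboolP[m km <-] fmin; exists m; split=> // l kl.
  by apply: fmin; apply/asboolP; exists l.
have [m mP] := choice tail_min.
pose g := fix g a := if a is b.+1 then m (g b).+1 else m 0%N.
have gS a : (g a < g a.+1)%N by case: (mP (g a).+1).
exists g; first exact: (homo_ltn ltn_trans gS).
apply: homo_leq => [x|y x z|a]; [exact: leqnn | exact: leq_trans |].
case: a => [|a] /=; apply: (mP _).2 => //.
exact: leq_trans (gS a) (ltnW (gS a.+1)).
Qed.

(** Subsequences are extracted coordinate by coordinate until all coordinates are nondecreasing. *)
Lemma dickson n (F : nat -> 'X_{1..n}) :
  exists t1 t2, (t1 < t2)%N /\ (F t1 <= F t2)%MM.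
Proof.
have [g g_inc gP] : exists2 g : nat -> nat, {homo g : a b / (a < b)%N} &
    forall i, i \in enum 'I_n -> {homo (fun a => F (g a) i) : a b / (a <= b)%N}.
  elim: (enum 'I_n) => [|i s [g g_inc gP]]; first by exists id.
  have [h h_inc hP] := nondecreasing_subseq (fun a => F (g a) i).
  exists (g \o h) => [a b ab|j]; first exact/g_inc/h_inc.
  rewrite inE => /orP[/eqP -> //|js] a b ab; apply: gP => //.
  by move: ab; rewrite leq_eqVlt => /orP[/eqP -> //|/h_inc/ltnW].
exists (g 0%N), (g 1%N); split; first exact: g_inc.
by apply/mnm_lepP => i; apply: gP; rewrite ?mem_enum.
Qed.

Section ChipFiring.
Variables (n : nat) (r : 'I_n -> nat) (beta : 'I_n -> 'X_{1..n}).
Implicit Types (v u w : 'X_{1..n}) (s t : seq 'I_n) (i j : 'I_n).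

(** The subtraction truncates, so this is the rewriting of x_i^(r_i) to x^(beta_i) only when
    [fireable r i v] holds. *)
Definition fire i v : 'X_{1..n} := (v - U_(i) *+ r i + beta i)%MM.
Definition fireable i v := (r i <= v i)%N.
Definition stable v := [forall i, v i < r i]%N.

Fixpoint legal s v :=
  if s is i :: s' then fireable i v && legal s' (fire i v) else true.
Definition run s v := foldl (fun u i => fire i u) v s.

Definition terminates v := exists2 s, legal s v & stable (run s v).

Lemma fireE i v l : fire i v l = (v l - (i == l) * r i + beta i l)%N.
Proof. by rewrite mnmDE mnmBE mulmnE mnm1E. Qed.

Lemma fireable_fire i j v : i != j -> fireable j v -> fireable j (fire i v).
Proof.
by move=> ij; rewrite /fireable fireE (negPf ij) mul0n subn0 => /leq_trans -> //; rewrite leq_addr.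
Qed.

Lemma fireC i j v : i != j -> fireable i v -> fireable j v ->
  fire i (fire j v) = fire j (fire i v).
Proof.
rewrite /fireable => ij iv jv; apply/mnmP => l; rewrite !fireE.
have [il|il] := eqVneq i l; have [jl|jl] := eqVneq j l; subst => //=; try lia.
Qed.

Lemma legal_rcons s i v : legal (rcons s i) v = legal s v && fireable i (run s v).
Proof. by elim: s v => [|j s IHs] v /=; rewrite ?andbT // IHs andbA. Qed.

(** Firing other indices never lowers entry i, so i stays fireable until it is fired, and must be
    fired before stability. Its first firing commutes with all earlier moves and can be brought to
    the front. *)
Lemma legal_exchange s v i : legal s v -> stable (run s v) -> fireable i v ->
  [/\ i \in s, legal (rem i s) (fire i v) & run (rem i s) (fire i v) = run s v].
Proof.
elim: s v => [|j s IHs] v /=.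
  by move=> _ /forallP/(_ i); rewrite ltnNge /fireable => /negPf ->.
move=> /andP[jv sv] st iv; rewrite inE; have [ij|ij] := eqVneq i j.
  by subst j.
have ji : j != i by rewrite eq_sym.
have [is_s lg rn] := IHs (fire j v) sv st (fireable_fire ji iv).
by rewrite is_s /= fireable_fire //= fireC.
Qed.

(** Induction on [t]: its first move is brought to the front of [s] by exchange, then removed from
    both. *)
Lemma legal_confluence s t v : legal s v -> stable (run s v) -> legal t v ->
  (size t <= size s)%N /\ (stable (run t v) -> perm_eq s t /\ run s v = run t v).
Proof.
elim: t s v => [|i t IHt] s v sv st /=.
  move=> _; split=> // /forallP v_st; case: s sv {st} => //= i s /andP[].
  by rewrite /fireable leqNgt v_st.
move=> /andP[iv tv]; have [is_s lg rn] := legal_exchange sv st iv.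
have st' : stable (run (rem i s) (fire i v)) by rewrite rn.
have [sz cf] := IHt _ _ lg st' tv; split=> [|/cf[pst <-]].
  by move: sz; rewrite size_rem //; case: s is_s {sv st lg rn st' cf}.
by rewrite rn; split=> //; rewrite (perm_trans (perm_to_rem is_s)) // perm_cons.
Qed.

Lemma stableN_fireable v : ~~ stable v -> exists i, fireable i v.
Proof. by rewrite negb_forall => /existsP[i]; rewrite -leqNgt; exists i. Qed.

Lemma terminatesN_recurrent v : ~ terminates v ->
  exists s t, [/\ legal s v, legal t (run s v), t != [::]
                & (run s v <= run t (run s v))%MM].
Proof.
move=> nt.
have step u : exists i, ~ terminates u -> fireable i u /\ ~ terminates (fire i u).
  have [tu|ntu] := pselect (terminates u).
    (* The choice function needs a default index at terminating positions; one exists, since with no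
       indices every position is stable. *)
    have [s _ _] := tu; have [i _] : exists i : 'I_n, True.
      apply: contrapT => no_i; apply: nt; exists [::] => //.
      by apply/forallP => i; case: no_i; exists i.
    by exists i.
  have [st|/stableN_fireable[i iu]] := boolP (stable u); first by case: ntu; exists [::].
  exists i => _; split=> // -[s sf st]; apply: ntu.
  by exists (i :: s) => //=; rewrite iu.
have [g gP] := choice step.
pose F m := iter m (fun u => fire (g u) u) v.
have Fnt m : ~ terminates (F m) by elim: m => //= m /gP[].
have Fseq a b : exists s, [/\ size s = b, legal s (F a) & run s (F a) = F (b + a)%N].
  elim: b => [|b [s [sz sv sr]]]; first by exists [::].
  exists (rcons s (g (F (b + a)%N))); rewrite size_rcons sz legal_rcons sv sr.
  by rewrite /run foldl_rcons -/(run s _) sr; split=> //; case: (gP _ (Fnt (b + a)%N)).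
have [m1 [m2 [lt12 le12]]] := dickson F.
have [s [_ sv sr]] := Fseq 0%N m1; rewrite addn0 in sr.
have [t [tz tv tr]] := Fseq m1 (m2 - m1)%N; rewrite subnK ?(ltnW lt12) // in tr.
exists s, t; rewrite sr tr; split=> //.
by rewrite -size_eq0 tz subn_eq0 -ltnNge.
Qed.

Section Weights.
Variable wt : 'I_n -> nat.
Definition weight v := (\sum_i v i * wt i)%N.

Lemma weight_fire i v : fireable i v ->
  (weight (fire i v) + r i * wt i = weight v + weight (beta i))%N.
Proof.
move=> iv; rewrite /weight.
rewrite (eq_bigr (fun l => (v l - (i == l) * r i) * wt l + beta i l * wt l))%N; last first.
  by move=> l _; rewrite fireE mulnDl.
rewrite big_split /= addnAC; congr (_ + _)%N.
rewrite (bigD1 i) //= [in RHS](bigD1 i) //= eqxx mul1n addnAC -mulnDl subnK //.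
by congr (_ + _)%N; apply: eq_bigr => l li; rewrite eq_sym (negPf li) mul0n subn0.
Qed.

Lemma decreasing_terminates v :
  (forall i, \sum_j beta i j * wt j < r i * wt i)%N -> terminates v.
Proof.
move=> dec; have [m] := ubnP (weight v); elim: m v => // m IHm v le_m.
have [st|/stableN_fireable[i iv]] := boolP (stable v); first by exists [::].
have [|s sf st] := IHm (fire i v); last by exists (i :: s) => //=; rewrite iv.
by have := weight_fire iv; have := dec i; rewrite -/(weight (beta i)); lia.
Qed.

(** Weight never drops along legal moves and starts at least at the degree, whereas a stable
    position has weight at most the sum of the [r i * wt i]. *)
Lemma nondecreasing_terminatesN v :
  (forall i, 0 < wt i)%N -> (forall i, r i * wt i <= \sum_j beta i j * wt j)%N ->
  (\sum_i r i * wt i < mdeg v)%N -> ~ terminates v.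
Proof.
move=> wt0 inc v_big [s sv /forallP st].
have le_w : (weight v <= weight (run s v))%N.
  elim: s v sv {v_big st} => //= i s IHs v /andP[iv /IHs/(leq_trans _)]; apply.
  by have := weight_fire iv; have := inc i; rewrite -/(weight (beta i)); lia.
move: v_big; apply/negP; rewrite -leqNgt mdegE.
apply: leq_trans (leq_trans le_w _); apply: leq_sum => i _; first exact: leq_pmulr.
by rewrite leq_mul2r ltnW ?orbT.
Qed.

End Weights.
End ChipFiring.

(** * The normal form of a polynomial *)

Section LinearExtension.
Variables (K : fieldType) (n : nat) (V : lmodType K) (F : 'X_{1..n} -> V).

Definition mlin (f : {mpoly K[n]}) : V := \sum_(m <- msupp f) f@_m *: F m.

Lemma mlinwE f d : (msize f <= d)%N -> mlin f = \sum_(m : 'X_{1..n < d}) f@_m *: F m.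
Proof.
pose I : subFinType _ := 'X_{1..n < d}.
move=> le_fd; rewrite /mlin (big_mksub I) /=; first last.
- by move=> x /msize_mdeg_lt/leq_trans/(_ le_fd).
- by rewrite msupp_uniq.
by rewrite big_rmcond //= => j /memN_msupp_eq0 ->; rewrite scale0r.
Qed.

Lemma mlin_is_linear : linear mlin.
Proof.
move=> b f g; pose d := (maxn (msize f) (maxn (msize g) (msize (b *: f + g)))).
have [df dg dbfg] : [/\ (msize f <= d)%N, (msize g <= d)%N & (msize (b *: f + g) <= d)%N].
  by rewrite /d !leq_max !leqnn !orbT.
rewrite !(@mlinwE _ d) // scaler_sumr -big_split /=; apply: eq_bigr => m _.
by rewrite mcoeffD mcoeffZ scalerDl scalerA.
Qed.

HB.instance Definition _ := GRing.isLinear.Build K {mpoly K[n]} V _ mlin mlin_is_linear.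

Lemma mlinX m : mlin 'X_[m] = F m.
Proof. by rewrite /mlin msuppX big_seq1 mcoeffX eqxx scale1r. Qed.

Lemma mlin_eq0 f : (forall m, m \in msupp f -> F m = 0) -> mlin f = 0.
Proof. by move=> F0; rewrite /mlin big_seq big1 // => m /F0 ->; rewrite scaler0. Qed.

End LinearExtension.

Section Order.
Variables (K : fieldType) (n : nat).

Definition order_ge d (f : {mpoly K[n]}) := forall m, m \in msupp f -> (d <= mdeg m)%N.

Lemma order_geM a b f g : order_ge a f -> order_ge b g -> order_ge (a + b) (f * g).
Proof.
move=> fa gb m /msuppM_le /allpairsP[[m1 m2] [/= m1f m2g ->]].
by rewrite mdegD leq_add ?fa ?gb.
Qed.

Lemma meval_at0 (f : {mpoly K[n]}) : f.@[[ffun=> 0]] = f@_0%MM.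
Proof.
elim/mpolyind: f => [|c m f _ _ IHf]; first by rewrite meval0 mcoeff0.
rewrite mevalD mevalZ mcoeffD mcoeffZ IHf mcoeffX; congr (_ * _ + _).
rewrite mevalX; have [->|m0] := eqVneq m 0%MM.
  by apply: big1 => i _; rewrite mnm0E expr0.
have [i mi] : exists i, m i != 0%N.
  apply/existsP; apply: contraNT m0; rewrite negb_exists => /forallP m0.
  by apply/eqP/mnmP => i; rewrite mnm0E; apply/eqP; have := m0 i; rewrite negbK.
by rewrite (bigD1 i) //= ffunE expr0n (negPf mi) mul0r.
Qed.

Lemma order_ge_exp d (f : {mpoly K[n]}) : f.@[[ffun=> 0]] = 0 -> order_ge d (f ^+ d).
Proof.
move=> f0; have f1 : order_ge 1 f.
  move=> m; rewrite mcoeff_msupp lt0n mdeg_eq0; apply: contraNneq => ->.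
  by rewrite -meval_at0 f0.
elim: d => [|d IHd] //; rewrite exprS; exact: order_geM f1 IHd.
Qed.

End Order.

Section NormalForm.
Variables (K : fieldType) (n : nat) (r : 'I_n -> nat) (beta : 'I_n -> 'X_{1..n}).
Variable c : {ffun 'I_n -> K}.
Local Notation p := (binomial_poly r beta c).
Local Notation fire := (fire r beta).
Local Notation legal := (legal r beta).
Local Notation run := (run r beta).
Local Notation stable := (stable r).
Local Notation terminates := (terminates r beta).

Definition coef (s : seq 'I_n) : K := \prod_(i <- s) c i.

Lemma fire_ideal i v : fireable r i v -> in_ideal p ('X_[v] - c i *: 'X_[fire i v]).
Proof.
move=> iv; have -> : 'X_[v] - c i *: 'X_[fire i v] = 'X_[v - U_(i) *+ r i] * p i.
  rewrite /binomial_poly mulrBr -scalerAr mpolyXn -!mpolyXD submK //.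
  apply/mnm_lepP => l; rewrite mulmnE mnm1E; have [<-|] := eqVneq i l; last by [].
  by rewrite mul1n.
exact/in_idealM/in_ideal_gen.
Qed.

Lemma run_ideal s v : legal s v -> in_ideal p ('X_[v] - coef s *: 'X_[run s v]).
Proof.
elim: s v => [|i s IHs] v /=.
  by move=> _; rewrite /coef big_nil scale1r subrr; apply: in_ideal0.
case/andP => iv /IHs sv; rewrite /coef big_cons -/(coef s) -scalerA.
rewrite -(subrKA (c i *: 'X_[fire i v])) -scalerBr.
by apply: in_idealD; [exact: fire_ideal | rewrite -mul_mpolyC; exact: in_idealM].
Qed.

Local Notation box := {dffun forall i : 'I_n, 'I_(r i)}.

Definition box_mnm (t : box) : 'X_{1..n} := [multinom (t i : nat) | i < n].

Lemma stable_box v : stable v -> exists t : box, v = box_mnm t.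
Proof.
move=> /forallP vr; exists (finfun (fun i => Ordinal (vr i))).
by apply/mnmP => i; rewrite mnmE ffunE.
Qed.

Lemma box_stable t : stable (box_mnm t).
Proof. by apply/forallP => i; rewrite mnmE. Qed.

Lemma box_mnm_inj : injective box_mnm.
Proof.
move=> t u /mnmP tu; apply/ffunP => i; apply/val_inj.
by have := tu i; rewrite !mnmE.
Qed.

Local Notation N := #|box|.

Definition box_row v : 'rV[K]_N := \row_j (box_mnm (enum_val j) == v)%:R.

(** The terminating play is an arbitrary choice. By confluence any other is a permutation of it with
    the same end, so the coefficient agrees too ([nf_mnm_run]). *)
Definition nf_mnm v : 'rV[K]_N :=
  if pselect (terminates v) is left tv
  then let s := s2val (cid2 tv) in coef s *: box_row (run s v) else 0.

Definition nf : {mpoly K[n]} -> 'rV[K]_N := mlin nf_mnm.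

HB.instance Definition _ := GRing.Linear.on nf.

Lemma nf_mnm_run s v : legal s v -> stable (run s v) ->
  nf_mnm v = coef s *: box_row (run s v).
Proof.
move=> sv st; rewrite /nf_mnm; case: pselect => [tv|[]]; last by exists s.
case: (cid2 tv) => t tv' tt /=.
have [_ /(_ tt)[pst ->]] := legal_confluence sv st tv'.
by rewrite /coef (perm_big _ pst).
Qed.

Lemma nf_mnm_nonterm v : ~ terminates v -> nf_mnm v = 0.
Proof. by rewrite /nf_mnm; case: pselect. Qed.

(** By exchange, [v] terminates exactly when [fire i v] does. *)
Lemma nf_mnm_fire i v : fireable r i v -> nf_mnm v = c i *: nf_mnm (fire i v).
Proof.
move=> iv; have [[s sf st]|nt] := pselect (terminates (fire i v)).
  rewrite (nf_mnm_run sf st) (@nf_mnm_run (i :: s)) ?scalerA /coef ?big_cons //=.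
  by rewrite iv.
rewrite (nf_mnm_nonterm nt) scaler0 nf_mnm_nonterm // => -[s sv st]; apply: nt.
have [_ lg rn] := legal_exchange sv st iv.
by exists (rem i s); rewrite ?rn.
Qed.

Lemma nf_ideal f : in_ideal p f -> nf f = 0.
Proof.
move=> [g ->]; rewrite linear_sum big1 //= => i _.
rewrite [g i]mpolyE mulr_suml linear_sum big1 //= => m _.
rewrite -scalerAl linearZ /= /binomial_poly mulrBr -scalerAr mpolyXn -!mpolyXD.
rewrite linearB linearZ /= /nf !mlinX (@nf_mnm_fire i (m + _)%MM); last first.
  by rewrite /fireable mnmDE mulmnE mnm1E eqxx mul1n leq_addl.
rewrite (_ : fire i _ = (m + beta i)%MM) ?subrr ?scaler0 //.
by rewrite /fire addmK.
Qed.

Definition nf_section (y : 'rV[K]_N) : {mpoly K[n]} :=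
  \sum_j y 0 j *: 'X_[box_mnm (enum_val j)].

Lemma box_row_enum j : box_row (box_mnm (enum_val j)) = delta_mx 0 j.
Proof.
apply/rowP => l; rewrite !mxE eqxx /=.
by rewrite (inj_eq box_mnm_inj) (inj_eq enum_val_inj).
Qed.

Lemma nf_sectionK y : nf (nf_section y) = y.
Proof.
rewrite linear_sum [RHS]row_sum_delta; apply: eq_bigr => j _.
rewrite linearZ /= /nf mlinX (@nf_mnm_run [::]) ?box_stable //=.
by rewrite /coef big_nil scale1r box_row_enum.
Qed.

Lemma nf_section_box v : stable v -> nf_section (box_row v) = 'X_[v].
Proof.
move=> /stable_box[t ->]; rewrite -(enum_rankK t) box_row_enum /nf_section.
rewrite (bigD1 (enum_rank t)) //= mxE !eqxx scale1r big1 ?addr0 // => j jt.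
by rewrite mxE (negPf jt) andbF scale0r.
Qed.

Lemma nf_section_is_linear : linear nf_section.
Proof.
move=> b y z; rewrite /nf_section scaler_sumr -big_split /=.
by apply: eq_bigr => j _; rewrite !mxE scalerDl scalerA.
Qed.

HB.instance Definition _ :=
  GRing.isLinear.Build K 'rV[K]_N {mpoly K[n]} _ nf_section nf_section_is_linear.

(** Stated for a predicate [I] so as to serve both the ideal, when all games end, and the local
    kernel at the origin. *)
Lemma sub_nf_section (I : {mpoly K[n]} -> Prop) f :
  (forall g, in_ideal p g -> I g) -> (forall g h, I g -> I h -> I (g + h)) ->
  (forall b g, I g -> I (b *: g)) -> (forall v, ~ terminates v -> I 'X_[v]) ->
  I (f - nf_section (nf f)).
Proof.
move=> IJ ID IZ Int; pose sec : {linear 'rV_N -> {mpoly K[n]}} := nf_section.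
rewrite {1}[f]mpolyE -[nf_section]/(sec : _ -> _) /nf /mlin (linear_sum sec) -sumrB.
apply: big_ind => [|g h|m _]; [exact/IJ/in_ideal0 | exact: ID |].
rewrite linearZ -scalerBr /=; apply: IZ.
have [[s sv st]|nt] := pselect (terminates m).
  by rewrite (nf_mnm_run sv st) linearZ /= nf_section_box //; apply/IJ/run_ideal.
by rewrite nf_mnm_nonterm // linear0 subr0; apply: Int.
Qed.

Section Local.
Variable wt : 'I_n -> nat.
Hypothesis wt_gt0 : forall i, (0 < wt i)%N.
Hypothesis wt_inc : forall i, (r i * wt i <= \sum_j beta i j * wt j)%N.
Let D := (\sum_i r i * wt i)%N.

(** After scaling, u = 1 - h with h(0) = 0, and the truncated geometric series inverts u up to
    h^(D+1). So f is congruent to h^(D+1) f, all of whose monomials have degree above D and hence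
    infinite games. *)
Lemma nf_loc_ker f : loc_ker p [ffun=> 0] f -> nf f = 0.
Proof.
move=> [u u0 uf]; pose b := u.@[[ffun=> 0]].
pose h := 1 - b^-1 *: u.
have h0 : h.@[[ffun=> 0]] = 0 by rewrite mevalB meval1 mevalZ mulVf ?subrr.
have -> : f = b^-1%:MP * (\sum_(i < D.+1) h ^+ i) * (u * f) + h ^+ D.+1 * f.
  have := subrX1 h D.+1; rewrite /h addrAC subrr add0r -/h => /(congr1 (fun x => x * f)).
  rewrite -mul_mpolyC => e; rewrite -[h ^+ _ in RHS](subrK 1) (mulrDl _ 1) e; ring.
rewrite linearD /= nf_ideal ?add0r; last exact: in_idealM.
apply: mlin_eq0 => m mf; apply: nf_mnm_nonterm.
apply: nondecreasing_terminatesN wt_gt0 wt_inc _.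
have hf : order_ge (D.+1 + 0) (h ^+ D.+1 * f) by apply: order_geM; [exact: order_ge_exp | move=> ?].
by have := hf m mf; rewrite addn0.
Qed.

(* A cycle [u -> run t u] with [u <= run t u] gives                            *)
(* [(1 - coef t * x^w) * x^u = 0] modulo the ideal, where [w = run t u - u].   *)
Lemma recurrent_loc_ker s t v :
  legal s v -> legal t (run s v) -> (run s v <= run t (run s v))%MM -> coef t != 1 ->
  loc_ker p [ffun=> 0] 'X_[v].
Proof.
move=> sv tv le_t ct; set u := run s v in tv le_t *; set w := (run t u - u)%MM.
have wE : run t u = (w + u)%MM by rewrite submK.
have x_u : loc_ker p [ffun=> 0] 'X_[u].
  (* Its value at the origin is 1 if [w] is nonzero and [1 - coef t] otherwise. *)
  exists (1 - coef t *: 'X_[w]).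
    rewrite mevalB mevalZ meval1 meval_at0 mcoeffX subr_eq0 eq_sym.
    by have [_|_] := eqVneq w 0%MM; rewrite ?mulr1 ?mulr0 ?oner_eq0 // eq_sym oner_eq0.
  by rewrite mulrBl mul1r -scalerAl -mpolyXD -wE; apply: run_ideal.
rewrite -['X_[v]](subrK (coef s *: 'X_[u])).
by apply: loc_kerD; [exact/loc_ker_ideal/run_ideal | exact: loc_kerZ].
Qed.

(** Finitely many monomials suffice as hypotheses: a monomial of degree at least D + 2 is a variable
    times one of degree above D, which again has an infinite game. *)
Lemma mult_at_origin_local :
  (forall v, (mdeg v < D.+2)%N -> ~ terminates v -> loc_ker p [ffun=> 0] 'X_[v]) ->
  mult_at p [ffun=> 0] (\prod_(i < n) r i).
Proof.
move=> small.
have nt_ker v : ~ terminates v -> loc_ker p [ffun=> 0] 'X_[v].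
  have [d] := ubnP (mdeg v); elim: d v => // d IHd v le_d nt.
  have [|big_v] := ltnP (mdeg v) D.+2; first by move=> /small; apply.
  have /existsP[i vi] : [exists i, v i != 0%N].
    apply: contraTT big_v; rewrite negb_exists => /forallP v0.
    by rewrite mdegE big1 // => i _; apply/eqP; have := v0 i; rewrite negbK.
  have vE : v = (U_(i) + (v - U_(i)))%MM by rewrite addmC submK // lep1mP.
  have dv : mdeg v = (mdeg (v - U_(i))).+1 by rewrite {1}vE mdegD mdeg1.
  rewrite vE mpolyXD; apply: loc_kerM; apply: IHd; first by rewrite -ltnS -dv.
  by apply: nondecreasing_terminatesN wt_gt0 wt_inc _; rewrite -ltnS -dv.
rewrite -card_dffun_ord.
apply: (@mult_at_of_surjection _ _ _ _ _ _ nf); first exact: linearP.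
  by move=> y; exists (nf_section y); rewrite nf_sectionK.
move=> f; split=> [f0|]; last exact: nf_loc_ker.
have := @sub_nf_section (loc_ker p [ffun=> 0]) f; rewrite f0 linear0 subr0; apply.
- exact: loc_ker_ideal.
- exact: loc_kerD.
- exact: loc_kerZ.
- exact: nt_ker.
Qed.

End Local.

Lemma nf_ker_global f : (forall v, terminates v) -> nf f = 0 <-> in_ideal p f.
Proof.
move=> term; split=> [f0|]; last exact: nf_ideal.
have := @sub_nf_section (in_ideal p) f; rewrite f0 linear0 subr0; apply=> //.
- exact: in_idealD.
- by move=> b g; rewrite -mul_mpolyC; exact: in_idealM.
Qed.

End NormalForm.

(** * Splitting off simple zeros *)

Lemma meval_horner_alg (K : fieldType) n (h : {mpoly K[n]}) (P : {poly K}) (a : 'I_n -> K) :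
  (horner_alg h P).@[a] = P.[h.@[a]].
Proof.
elim/poly_ind: P => [|P c IHP]; first by rewrite rmorph0 meval0 horner0.
rewrite rmorphD rmorphM /= horner_algX horner_algC mevalD mevalM IHP.
by rewrite alg_mpolyC mevalC !hornerE.
Qed.

Lemma separating_poly (K : fieldType) n (b : {ffun 'I_n -> K}) (s : seq {ffun 'I_n -> K}) :
  b \notin s ->
  exists2 g : {mpoly K[n]}, g.@[b] = 1 & forall a, a \in s -> g.@[a] = 0.
Proof.
elim: s => [|a s IHs]; first by exists 1; rewrite ?meval1.
rewrite inE negb_or => /andP[ba /IHs[g gb gs]].
have [i bai] : exists i, b i != a i.
  apply/existsP; apply: contraNT ba; rewrite negb_exists => /forallP ba.
  by apply/eqP/ffunP => i; apply/eqP; have := ba i; rewrite negbK.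
exists ((b i - a i)^-1 *: ('X_i - (a i)%:MP) * g).
  rewrite mevalM gb mulr1 mevalZ mevalB mevalXU mevalC mulVf //.
  by rewrite subr_eq0.
move=> a'; rewrite inE mevalM => /orP[/eqP ->|/gs ->]; last by rewrite mulr0.
by rewrite mevalZ mevalB mevalXU mevalC subrr mulr0 mul0r.
Qed.

Section FiniteNullstellensatz.
Variables (K : closedFieldType) (n N : nat) (J : {mpoly K[n]} -> Prop).
Variable phi : {linear {mpoly K[n]} -> 'rV[K]_N}.
Hypothesis phi_ker : forall f, phi f = 0 -> J f.

(** The N + 1 first powers of [h] have linearly dependent images in dimension N. *)
Lemma algebraic_mod (h : {mpoly K[n]}) : exists2 P : {poly K}, P != 0 & J (horner_alg h P).
Proof.
pose M : 'M[K]_(N.+1, N) := \matrix_i phi (h ^+ i).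
have /rowV0Pn[v /sub_kermxP vM v0] : kermx M != 0.
  rewrite kermx_eq0; apply/negP => /eqP rM.
  by have := rank_leq_col M; rewrite rM ltnn.
exists (\poly_(i < N.+1) v 0 (inord i)).
  apply: contraNneq v0 => P0; apply/eqP/rowP => i.
  have := congr1 (fun P : {poly K} => P`_i) P0.
  by rewrite coef_poly ltn_ord inord_val coef0 mxE.
apply: phi_ker; rewrite poly_def !linear_sum -[RHS]vM mulmx_sum_row.
apply: eq_bigr => i _; rewrite inord_val rowK linearZ /=.
by rewrite -scalerAl mul1r linearZ /= rmorphXn /= horner_algX.
Qed.

Definition is_ideal (I : {mpoly K[n]} -> Prop) :=
  [/\ forall f, J f -> I f, forall f g, I f -> I g -> I (f + g)
    & forall h f, I f -> I (h * f)].

(** If every [h - z] were invertible modulo I, so would be their product over the roots of an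
    annihilating polynomial P of [h]; but that product is P(h) up to a scalar, which lies in J. *)
Lemma proper_extension I (h : {mpoly K[n]}) : is_ideal I -> ~ I 1 ->
  exists z : K, exists I' : {mpoly K[n]} -> Prop,
    [/\ is_ideal I', ~ I' 1, forall f, I f -> I' f & I' (h - z%:MP)].
Proof.
move=> [JI ID IM] I1; have I0 : I 0 by apply/JI/phi_ker/linear0.
pose E z f := exists g, I (f - g * (h - z%:MP)).
have EI z : is_ideal (E z).
  split=> [f Jf|f g [f' If] [g' Ig]|u f [f' If]].
  - by exists 0; rewrite mul0r subr0; apply: JI.
  - exists (f' + g').
    rewrite (_ : _ - _ = f - f' * (h - z%:MP) + (g - g' * (h - z%:MP))); last by ring.
    exact: ID.
  - exists (u * f'); rewrite (_ : _ - _ = u * (f - f' * (h - z%:MP))); last by ring.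
    exact: IM.
suff [z Ez] : exists z, ~ E z 1.
  exists z, (E z); split=> // [f If|]; first by exists 0; rewrite mul0r subr0.
  by exists 1; rewrite mul1r subrr.
apply: contrapT => no_z.
have E1 z : E z 1 by apply: contrapT => Ez; apply: no_z; exists z.
have [P P0 JP] := algebraic_mod h; have [zs PE] := closed_field_poly_normal P.
have [g Ig] : exists g, I (1 - g * \prod_(z <- zs) (h - z%:MP)).
  elim: zs {PE} => [|z zs [g Ig]]; first by exists 1; rewrite big_nil mulr1 subrr.
  have [g' Ig'] := E1 z; exists (g * g'); rewrite big_cons.
  rewrite (_ : _ - _ = 1 * (1 - g * \prod_(z <- zs) (h - z%:MP)) +
    g * \prod_(z <- zs) (h - z%:MP) * (1 - g' * (h - z%:MP))); last by ring.
  by apply: ID; apply: IM.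
apply: I1; rewrite -[1](subrK (g * \prod_(z <- zs) (h - z%:MP))); apply: ID => //.
apply: (IM); have -> : \prod_(z <- zs) (h - z%:MP) = (lead_coef P)^-1%:MP * horner_alg h P.
  rewrite {2}PE linearZ /= alg_mpolyC mulrA -mpolyCM mulVf ?lead_coef_eq0 // mpolyC1 mul1r.
  rewrite rmorph_prod; apply: eq_bigr => z _.
  by rewrite rmorphB /= horner_algX horner_algC alg_mpolyC.
by apply/IM/JI.
Qed.

(** Adjoining ['X_i - a i] one variable at a time keeps the ideal proper. The result contains f -
    f(a), so for f in I it contains the constant f(a), which must vanish. *)
Lemma finite_nullstellensatz I : is_ideal I -> ~ I 1 ->
  exists a : {ffun 'I_n -> K}, forall f, I f -> f.@[a] = 0.
Proof.
move=> II I1.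
have [a [I' [[JI' I'D I'M] I'1 II' aI']]] : exists a : {ffun 'I_n -> K}, exists I',
    [/\ is_ideal I', ~ I' 1, forall f, I f -> I' f
      & forall i, i \in enum 'I_n -> I' ('X_i - (a i)%:MP)].
  elim: (enum 'I_n) => [|i s [a [I' [iI' I'1 II' aI']]]]; first by exists [ffun=> 0], I.
  have [z [I'' [iI'' I''1 I'I'' zI'']]] := proper_extension 'X_i iI' I'1.
  exists [ffun j => if j == i then z else a j], I''; split=> // [f /II'/I'I'' //|j].
  by rewrite inE ffunE; case: eqVneq => [-> //|_ /= /aI'/I'I''].
exists a => f /II' I'f; apply: contrapT => /eqP fa; apply: I'1.
have I'C : I' (f.@[a])%:MP.
  have -> : (f.@[a])%:MP = f + -1 * (f - (f.@[a])%:MP) by ring.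
  apply: (I'D) => //; apply: (I'M); have [g ->] := in_ideal_subr_eval a f.
  apply: big_ind => [|g1 g2|i _]; [exact/JI'/phi_ker/linear0 | exact: I'D |].
  by apply: I'M; apply: aI'; rewrite mem_enum.
have -> : 1 = (f.@[a])^-1%:MP * (f.@[a])%:MP :> {mpoly K[n]} by rewrite -mpolyCM mulVf.
exact: I'M.
Qed.

End FiniteNullstellensatz.

Section ResidualPoint.
Variables (K : closedFieldType) (n m N : nat) (q : 'I_m -> {mpoly K[n]}).
Variable phi : {linear {mpoly K[n]} -> 'rV[K]_N}.
Hypothesis phi_surj : forall y, exists f, phi f = y.
Hypothesis phi_ker : forall f, phi f = 0 <-> in_ideal q f.
Variables (b : {ffun 'I_n -> K}) (s : seq {ffun 'I_n -> K}).
Hypothesis s_uniq : uniq s.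
Hypothesis bNs : b \notin s.
Hypothesis zeros : forall a, zero_of q a -> a = b \/ a \in s.
Hypothesis s_simple : forall a, a \in s -> forall f, loc_ker q a f <-> f.@[a] = 0.

(** Were the colon ideal of [f] proper, it would have a zero a, necessarily [b] or in [s]; yet local
    membership at a gives an element of it not vanishing at a. *)
Lemma in_ideal_local f :
  loc_ker q b f -> (forall a, a \in s -> f.@[a] = 0) -> in_ideal q f.
Proof.
move=> bf sf; apply: contrapT => nJf; pose I g := in_ideal q (g * f).
have II : is_ideal (in_ideal q) I.
  split=> [g Jg|g h Ig Ih|h g Ig]; rewrite /I.
  - exact: in_idealMr.
  - by rewrite mulrDl; apply: in_idealD.
  - by rewrite -mulrA; apply: in_idealM.
have ker_J g : phi g = 0 -> in_ideal q g by move=> /phi_ker.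
have I1 : ~ I 1 by rewrite /I mul1r.
have [a Ia] := finite_nullstellensatz ker_J II I1.
have [u ua uf] : loc_ker q a f.
  have [-> //|as_] := zeros (fun i => Ia _ (in_idealMr _ (in_ideal_gen q i))).
  exact/(s_simple as_)/sf.
by move: ua; rewrite Ia ?eqxx.
Qed.

(* If [h] vanishes on [s] but not at [b], and [h] is a root of [X^M * P]       *)
(* modulo the ideal, with [P 0 != 0], then [P(h)] is killed by [h^M].          *)
Lemma local_idempotent :
  exists2 e, loc_ker q b e & forall a, a \in s -> e.@[a] = 1.
Proof.
have [h hb hs] := separating_poly bNs.
have ker_J g : phi g = 0 -> in_ideal q g by move=> /phi_ker.
have [P P0 JP] := algebraic_mod ker_J h.
have [M [P1]] := multiplicity_XsubC P 0; rewrite P0 /= subr0 => P10 PE.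
have P1n0 : P1.[0] != 0 by rewrite -rootE.
exists ((P1.[0])^-1 *: horner_alg h P1).
  apply: loc_kerZ; exists (h ^+ M); first by rewrite rmorphXn /= hb expr1n oner_neq0.
  by move: JP; rewrite PE rmorphM rmorphXn /= horner_algX mulrC.
by move=> a /hs ha; rewrite mevalZ meval_horner_alg ha mulVf.
Qed.

(** Modulo the ideal, the local kernel at [b] has as basis the images of polynomials [F j] in that
    kernel dual to the points of [s]. The local ring is the quotient of the N-dimensional algebra by
    their span. *)
Lemma mult_at_residual : exists2 mu, (mu + size s = N)%N & mult_at q b mu.
Proof.
have [e be se] := local_idempotent.
pose pt (j : 'I_(size s)) := tnth (in_tuple s) j.
have ptE j : pt j \in s by apply: mem_tnth.
have pt_inj : injective pt by apply/tuple_uniqP.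
have ex_L j : exists g : {mpoly K[n]}, forall l, g.@[pt l] = (l == j)%:R.
  have jNs : pt j \notin rem (pt j) s by rewrite mem_rem_uniq // !inE eqxx.
  have [g gj gs] := separating_poly jNs; exists g => l.
  have [-> //|lj] := eqVneq l j; apply: gs.
  by rewrite mem_rem_uniq // !inE ptE andbT (inj_eq pt_inj).
have [L LE] := choice ex_L.
pose F j := L j * e.
have F_ker j : loc_ker q b (F j) by apply: loc_kerM.
have FE j l : (F j).@[pt l] = (l == j)%:R by rewrite mevalM LE se ?mulr1.
pose S : 'M[K]_(size s, N) := \matrix_j phi (F j).
have SE (y : 'rV_(size s)) : y *m S = phi (\sum_j y 0 j *: F j).
  rewrite mulmx_sum_row linear_sum; apply: eq_bigr => j _.
  by rewrite rowK linearZ.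
have sumFE (y : 'rV_(size s)) l : (\sum_j y 0 j *: F j).@[pt l] = y 0 l.
  rewrite (linear_sum (meval (pt l))) (bigD1 l) //= mevalZ FE eqxx mulr1 big1 ?addr0 // => j jl.
  by rewrite mevalZ FE eq_sym (negPf jl) mulr0.
have J_s f a : in_ideal q f -> a \in s -> f.@[a] = 0.
  by move=> /(@loc_ker_ideal _ _ _ q a) Jf /s_simple/(_ f) [+ _]; apply.
have rankS : \rank S = size s.
  apply/eqP; rewrite -[_ == _]/(row_free S); apply: inj_row_free => y.
  rewrite SE => /phi_ker Jy; apply/rowP => l.
  by rewrite -sumFE (J_s _ _ Jy) ?mxE.
(* Right multiplication by [C] is onto and its kernel is the row space of [S]. *)
pose C := col_base (cokermx S).
have yC0 (y : 'rV_N) : y *m C = 0 <-> (y <= S)%MS.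
  have -> : (y <= S)%MS = (y *m C *m row_base (cokermx S) == 0).
    by rewrite submxE -mulmxA mulmx_base.
  split=> [->|/eqP yC]; first by rewrite mul0mx.
  apply: (row_free_inj (row_base_free (cokermx S))).
  by rewrite mul0mx.
exists (\rank (cokermx S)).
  by rewrite mxrank_coker rankS subnK // -rankS rank_leq_col.
apply: (@mult_at_of_surjection _ _ _ _ _ _ (fun f => phi f *m C)).
- by move=> c f g; rewrite linearP mulmxDl -scalemxAl.
- move=> y; have /row_fullP[D DC] := col_base_full (cokermx S).
  by have [f fE] := phi_surj (y *m D); exists f; rewrite fE -mulmxA DC mulmx1.
move=> f; rewrite yC0; split=> [/submxP[y]|bf].
  rewrite SE => fy; rewrite -[f](subrK (\sum_j y 0 j *: F j)); apply: loc_kerD.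
    by apply/loc_ker_ideal/phi_ker; rewrite linearB /= fy subrr.
  by apply: loc_ker_sum => j _; apply: loc_kerZ.
(* Subtracting the interpolation of [f] on [s] leaves an element that vanishes on [s] and is locally
   zero at [b], hence lies in the ideal. *)
pose y : 'rV[K]_(size s) := \row_j f.@[pt j].
apply/submxP; exists y; apply/eqP; rewrite SE -subr_eq0 -linearB; apply/eqP/phi_ker.
apply: in_ideal_local => [|a /(nthP b)[l ls <-]].
  by apply: loc_kerB => //; apply: loc_ker_sum => j _; apply: loc_kerZ.
rewrite -[nth _ _ _](tnth_nth _ (in_tuple s) (Ordinal ls)) mevalB sumFE mxE.
by rewrite subrr.
Qed.

End ResidualPoint.

(** * Genericity *)

Lemma binomial_poly_overE (k : fieldType) (K : fieldType) (iota : {rmorphism k -> K})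
    n (r : 'I_n -> nat) (beta : 'I_n -> 'X_{1..n}) (c : {ffun 'I_n -> k}) :
  binomial_poly_over r beta iota c = binomial_poly r beta [ffun i => iota (c i)].
Proof.
apply/funext => i; rewrite /binomial_poly_over /binomial_poly rmorphB rmorphXn /=.
by rewrite map_mpolyX map_mpolyZ map_mpolyX ffunE.
Qed.

Lemma generic_nonvanishing (k : fieldType) n (f : {mpoly k[n]}) (c0 : {ffun 'I_n -> k})
    (P : {ffun 'I_n -> k} -> Prop) :
  f.@[c0] != 0 -> (forall c : {ffun 'I_n -> k}, f.@[c] != 0 -> in_torus c /\ P c) -> generic P.
Proof.
move=> f0 fP; exists (fun c : {ffun 'I_n -> k} => f.@[c] != 0); split=> [|c /fP[]//||c /fP[]//].
  by exists (eq f) => c; split=> [fc|[_ <-]//]; exists f.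
by exists c0.
Qed.

Lemma pow2_inj (k : fieldType) : [pchar k] =i pred0 ->
  injective (fun a : nat => 2 ^+ a : k).
Proof.
move=> /pcharf0P char0.
suff le a b : (a <= b)%N -> 2 ^+ a = 2 ^+ b :> k -> a = b.
  move=> a b ab; have [ab'|/ltnW ba] := leqP a b; first exact: le.
  by apply/esym/le.
move=> ab /eqP; rewrite -subr_eq0 -opprB oppr_eq0 -!natrX -natrB ?leq_exp2l // char0.
by rewrite subn_eq0 leq_exp2l // => ba; apply/eqP; rewrite eqn_leq ab.
Qed.

Section Zeros.
Variables (k : fieldType) (n : nat) (r : 'I_n -> nat) (beta : 'I_n -> 'X_{1..n}).
Hypothesis irr : irreducible_system k r beta.
Variables (K : fieldType) (c : {ffun 'I_n -> K}).
Local Notation p := (binomial_poly r beta c).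

Lemma zero_of_origin : zero_of p [ffun=> 0].
Proof.
have [nf _] := irr; move=> i; have [r0 b0 _] := nf i.
rewrite meval_at0 /binomial_poly mcoeffB mcoeffZ mcoeffXn mcoeffX (negPf b0) mulr0 subr0.
by rewrite -mdeg_eq0 mdegMn mdeg1 mul1n (gtn_eqF r0).
Qed.

(** If the support of [a] is proper and nonempty, some i in it has x^(beta_i) vanishing at [a],
    which forces a_i = 0. *)
Lemma zero_of_cases a : zero_of p a -> a = [ffun=> 0] \/ forall i, a i != 0.
Proof.
move=> za; pose I := [set i | a i != 0].
have [I0|I0] := eqVneq I set0.
  left; apply/ffunP => i; rewrite ffunE; apply/eqP.
  by have := in_set0 i; rewrite -I0 inE => /negbFE.
have [IT|IT] := eqVneq I [set: 'I_n].
  by right=> i; have := in_setT i; rewrite -IT inE.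
have [|i iI [j jI bij]] := irreducible_exit irr I0; first by rewrite properT.
have aj : a j = 0 by move: jI; rewrite inE negbK => /eqP.
move: (za i) iI; rewrite /binomial_poly mevalB mevalZ rmorphXn /= mevalXU mevalX.
rewrite (bigD1 j) //= aj expr0n (negPf bij) mul0r mulr0 subr0 inE => /eqP.
by rewrite expf_eq0 => /andP[_ ->].
Qed.

Lemma number_of_zeros_torus mu (s : seq {ffun 'I_n -> K}) :
  (0 < n)%N -> uniq s -> (forall a, a \in s <-> zero_of p a /\ forall i, a i != 0) ->
  mult_at p [ffun=> 0] mu -> (forall a, a \in s -> mult_at p a 1) ->
  number_of_zeros p (mu + size s).
Proof.
move=> n0 s_uniq sP mult0 mult1; have i0 := Ordinal n0.
have zs : [ffun=> 0] \notin s.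
  by apply/negP => /sP[_ /(_ i0)]; rewrite ffunE eqxx.
exists ([ffun=> 0] :: s), (fun a => if a == [ffun=> 0] then mu else 1%N); split.
- by rewrite /= zs.
- move=> a; rewrite inE; split=> [/orP[/eqP ->|/sP[]//]|za]; first exact: zero_of_origin.
  have [->|a0] := zero_of_cases za; first by rewrite eqxx.
  by apply/orP; right; apply/sP.
- move=> a; rewrite inE; case: eqVneq => [-> //|_ /= as_]; exact: mult1.
rewrite big_cons eqxx; congr (_ + _)%N; rewrite big_seq (eq_bigr (fun=> 1%N)).
  by rewrite -big_seq sum1_size.
by move=> a as_; case: eqVneq as_ zs => // -> ->.
Qed.

End Zeros.

(** * The global and the local case *)

Section Main.
Variables (k : fieldType) (K : closedFieldType) (iota : {rmorphism k -> K}).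
Variables (n : nat) (r : 'I_n -> nat) (beta : 'I_n -> 'X_{1..n}).
Hypothesis char_k : [pchar k] =i pred0.
Hypothesis n_gt0 : (0 < n)%N.
Hypothesis irr : irreducible_system k r beta.

Local Notation delta := `|\det (exponent_mx r beta)|%N.
Local Notation p c := (binomial_poly_over r beta iota c).

Let char_K : [pchar K] =i pred0.
Proof. by move=> q; rewrite (fmorph_pchar iota) char_k. Qed.

Definition torus_simple (c : {ffun 'I_n -> K}) (s : seq {ffun 'I_n -> K}) :=
  let p := binomial_poly r beta c in
  [/\ uniq s, forall a, a \in s <-> zero_of p a /\ forall i, a i != 0, size s = delta
    & forall a, a \in s ->
       (forall f, loc_ker p a f <-> f.@[a] = 0) /\ mult_at p a 1].

Lemma torus_zeros_simple (c : {ffun 'I_n -> K}) :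
  \det (exponent_mx r beta) != 0 -> (forall i, c i != 0) -> exists s, torus_simple c s.
Proof.
move=> detB c0; have [s [s_uniq sP ssz]] := torus_zeros char_K detB c0.
by exists s; split=> // a /sP[za a0]; apply: mult_at_torus.
Qed.

Lemma global_generic : global_system r beta ->
  exists2 mu, (mu + delta = \prod_(i < n) r i)%N &
    generic (fun c => number_of_zeros (p c) (\prod_(i < n) r i) /\
                      mult_at (p c) [ffun=> 0] mu).
Proof.
move=> gl; have [w w0 w_dec] := global_weight gl.
have detB : \det (exponent_mx r beta) != 0 by rewrite lt0r_neq0 ?global_det_gt0.
have term v : terminates r beta v by apply: decreasing_terminates w_dec.
have key (c : {ffun 'I_n -> K}) : (forall i, c i != 0) ->
    exists2 mu, (mu + delta = \prod_(i < n) r i)%N &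
      number_of_zeros (binomial_poly r beta c) (\prod_(i < n) r i) /\
      mult_at (binomial_poly r beta c) [ffun=> 0] mu.
  move=> c0; have [s [s_uniq sP ssz s1]] := torus_zeros_simple detB c0.
  have Ns : [ffun=> 0] \notin s.
    by apply/negP => /sP[_ /(_ (Ordinal n_gt0))]; rewrite ffunE eqxx.
  pose phi : {linear {mpoly K[n]} -> 'rV_#|{dffun forall i : 'I_n, 'I_(r i)}|} := nf r beta c.
  have phi_surj y : exists f, phi f = y by exists (nf_section y); apply: nf_sectionK.
  have phi_ker f : phi f = 0 <-> in_ideal (binomial_poly r beta c) f.
    exact: nf_ker_global.
  have [a za|a /s1[]//|mu muE mult_mu] := mult_at_residual phi_surj phi_ker s_uniq Ns.
    by have [->|a0] := zero_of_cases irr za; [left | right; apply/sP].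
  rewrite -card_dffun_ord -muE -ssz; exists mu => //; split=> //.
  by apply: (number_of_zeros_torus irr n_gt0 s_uniq sP mult_mu) => a /s1[].
(* The equation determines [mu], so its value at one torus point serves all. *)
have [mu muE _] : exists2 mu, (mu + delta = \prod_(i < n) r i)%N & True.
  have [|mu muE _] := key [ffun=> 1]; first by move=> i; rewrite ffunE oner_neq0.
  by exists mu.
exists mu => //; apply: (@generic_nonvanishing _ _ (\prod_i 'X_i) [ffun=> 1]).
  rewrite rmorph_prod; apply/prodf_neq0 => i _.
  by rewrite /= mevalXU ffunE oner_neq0.
move=> c; rewrite rmorph_prod => /prodf_neq0 c0.
have ct : in_torus c by move=> i; have := c0 i isT; rewrite /= mevalXU.
split=> //; rewrite binomial_poly_overE.
have [|mu' mu'E] := key [ffun i => iota (c i)].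
  by move=> i; rewrite ffunE fmorph_eq0 ct.
by have -> : mu' = mu by apply: (@addIn delta); rewrite mu'E.
Qed.

(* At such points the genericity conditions [c^l != 1] compare two distinct    *)
(* powers of 2, so the generic set is non-empty in characteristic zero.        *)
Definition pow2_point (e : 'I_n -> nat) : {ffun 'I_n -> k} := [ffun i => 2 ^+ e i].

Lemma meval_pow2 (e : 'I_n -> nat) (m : 'X_{1..n}) :
  ('X_[m]).@[pow2_point e] = 2 ^+ (\sum_i e i * m i)%N.
Proof.
rewrite mevalX (big_morph _ (exprD 2) (expr0 2)); apply: eq_bigr => i _.
by rewrite ffunE exprM.
Qed.

(** When det B = 0, [g] expresses c^l != 1 for a left kernel vector [l], written with the positive
    and negative parts of [l]; then no torus zero exists. *)
Lemma torus_generic : exists (g : {mpoly k[n]}) (e : 'I_n -> nat),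
  [/\ forall i, (0 < e i)%N, g.@[pow2_point e] != 0
    & forall c : {ffun 'I_n -> k}, g.@[c] != 0 -> in_torus c ->
        exists s, torus_simple [ffun i => iota (c i)] s].
Proof.
have [detB|detB] := eqVneq (\det (exponent_mx r beta)) 0; last first.
  exists 1, (fun=> 1%N); split=> // [|c _ ct]; first by rewrite meval1 oner_neq0.
  by apply: torus_zeros_simple => // i; rewrite ffunE fmorph_eq0 ct.
have [l l0 lP] := torus_zeros_singular detB.
pose lp := [multinom (if (0 <= l 0 i)%R then `|(l 0 i)%R|%N else 0%N) | i < n].
pose lm := [multinom (if (0 <= l 0 i)%R then 0%N else `|(l 0 i)%R|%N) | i < n].
exists ('X_[lp] - 'X_[lm]).
have [e e0 eP] : exists2 e : 'I_n -> nat, (forall i, 0 < e i)%N &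
    (\sum_i e i * lp i != \sum_i e i * lm i)%N.
  have lpm i : l 0 i != 0 -> lp i != lm i.
    by rewrite !mnmE -absz_eq0; case: ifP => _ //; rewrite eq_sym.
  (* [e] must not be orthogonal to [l]: if the all-ones vector is, raising it by one where [l] is
     nonzero works. *)
  have [sum_eq|] := eqVneq (\sum_i 1 * lp i)%N (\sum_i 1 * lm i)%N; last by exists (fun=> 1%N).
  have [i li] : exists i, l 0 i != 0.
    apply/existsP; apply: contraNT l0; rewrite negb_exists => /forallP l0.
    by apply/eqP/rowP => i; rewrite mxE; apply/eqP; have := l0 i; rewrite negbK.
  exists (fun j => 1 + (j == i))%N => //.
  have sumE (m : 'X_{1..n}) : (\sum_j (1 + (j == i)) * m j = \sum_j 1 * m j + m i)%N.
    rewrite (eq_bigr (fun j => 1 * m j + (j == i) * m j))%N; last by move=> j _; rewrite mulnDl.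
    rewrite big_split /=; congr (_ + _)%N; rewrite (bigD1 i) //= eqxx mul1n big1 ?addn0 // => j ji.
    by rewrite (negPf ji).
  by rewrite !sumE sum_eq eqn_add2l lpm.
exists e; split=> // [|c].
  rewrite mevalB !meval_pow2 subr_eq0; apply: contraNneq eP => /(pow2_inj char_k) ->.
  by [].
rewrite mevalB !mevalX subr_eq0 => neq ct.
have ct' i : [ffun i => iota (c i)] i != 0 by rewrite ffunE fmorph_eq0 ct.
have no_zero a : ~ (zero_of (binomial_poly r beta [ffun i => iota (c i)]) a /\ forall i, a i != 0).
  move=> [za a0]; have := lP K _ a a0 za; apply/eqP; apply: contraNneq neq => l1.
  rewrite -(inj_eq (fmorph_inj iota)) !rmorph_prod /=.
  have lm0 : \prod_i iota (c i ^+ lm i) != 0.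
    by apply/prodf_neq0 => i _; rewrite fmorph_eq0 expf_neq0 ?ct.
  apply/eqP; apply: (mulIf (invr_neq0 lm0)); rewrite mulfV // -[RHS]l1 -prodfV -big_split /=.
  apply: eq_bigr => i _; rewrite !mnmE ffunE !rmorphXn.
  case: ifP => li; first by rewrite expr0 invr1 mulr1 -[in RHS](gez0_abs li) -exprnP.
  by rewrite expr0 mul1r; case: (l 0 i) li => // m _; rewrite NegzE -exprnN.
exists [::]; split=> // [a|]; first by split=> // /no_zero.
by rewrite detB.
Qed.

(** The condition is that the coefficient of the recurrent play [t] differs from 1. At
    [pow2_point e] it is a positive power of 2, so one point serves all [v] at once. *)
Lemma nonterminating_generic (e : 'I_n -> nat) (v : 'X_{1..n}) :
  (forall i, 0 < e i)%N ->
  exists h : {mpoly k[n]}, h.@[pow2_point e] != 0 /\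
    forall c : {ffun 'I_n -> k}, h.@[c] != 0 -> ~ terminates r beta v ->
      loc_ker (binomial_poly r beta [ffun i => iota (c i)]) [ffun=> 0] 'X_[v].
Proof.
move=> e0; have [tv|nt] := pselect (terminates r beta v).
  by exists 1; split=> [|c _ /(_ tv)//]; rewrite meval1 oner_neq0.
have [s [t [sv tv t0 le_t]]] := terminatesN_recurrent nt.
have hE c : (\prod_(i <- t) 'X_i - 1 : {mpoly k[n]}).@[c] = \prod_(i <- t) c i - 1.
  rewrite mevalB meval1 rmorph_prod; congr (_ - _).
  by apply: eq_bigr => i _; apply: mevalXU.
exists (\prod_(i <- t) 'X_i - 1); split=> [|c]; rewrite hE subr_eq0.
  rewrite (eq_bigr (fun i => 2 ^+ e i)); last by move=> i _; rewrite ffunE.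
  rewrite -(big_morph _ (exprD 2) (expr0 2)) -(expr0 2) (inj_eq (pow2_inj char_k)).
  by case: t t0 {sv tv le_t hE} => // i t _; rewrite big_cons -lt0n addn_gt0 e0.
move=> ct _; apply: recurrent_loc_ker sv tv le_t _.
rewrite /coef (eq_bigr (fun i => iota (c i))); last by move=> i _; rewrite ffunE.
by rewrite -rmorph_prod fmorph_eq1.
Qed.

Lemma local_generic : ~ global_system r beta ->
  generic (fun c => number_of_zeros (p c) (\prod_(i < n) r i + delta) /\
                    mult_at (p c) [ffun=> 0] (\prod_(i < n) r i)).
Proof.
move=> ngl; have [w w0 w_inc] := local_weight irr ngl.
have [g [e [e0 ge gP]]] := torus_generic.
have [h hP] := choice (fun v => nonterminating_generic v e0).
pose D := (\sum_i r i * w i)%N.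
(* The three factors ensure nonzero coefficients, the count of torus zeros, and local vanishing of
   the nonterminating monomials of small degree. *)
pose f : {mpoly k[n]} := \prod_i 'X_i * g * \prod_(v : 'X_{1..n < D.+2}) h v.
apply: (@generic_nonvanishing _ _ f (pow2_point e)) => [|c].
  rewrite /f !mevalM !rmorph_prod !mulf_neq0 //; apply/prodf_neq0 => i _ /=.
    by rewrite mevalXU ffunE expf_neq0 // ((pcharf0P _).1 char_k 2).
  by case: (hP i).
rewrite /f !mevalM !rmorph_prod !mulf_eq0 !negb_or.
case/andP=> /andP[/prodf_neq0 c0 gc] /prodf_neq0 hc.
have ct : in_torus c by move=> i; have := c0 i isT; rewrite /= mevalXU.
split=> //; rewrite binomial_poly_overE.
have [s [s_uniq sP ssz s1]] := gP c gc ct.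
have mult0 : mult_at (binomial_poly r beta [ffun i => iota (c i)]) [ffun=> 0] (\prod_(i < n) r i).
  apply: (mult_at_origin_local w0 w_inc) => v v_small; apply: (hP v).2.
  exact: (hc (BMultinom v_small)).
split=> //; rewrite -ssz.
by apply: (number_of_zeros_torus irr n_gt0 s_uniq sP mult0) => a /s1[].
Qed.

End Main.

Theorem theorem3p5 (k : fieldType) (K : closedFieldType)
    (iota : {rmorphism k -> K}) (n : nat)
    (r : 'I_n -> nat) (beta : 'I_n -> 'X_{1..n})
    (char_k : [pchar k] =i pred0)
    (K_alg : forall x : K, algebraicOver iota x)
    (n_gt0 : (0 < n)%N)
    (irr : irreducible_system k r beta) :
  exists d mu : nat,
    [/\ generic (fun c : {ffun 'I_n -> k} =>
          number_of_zeros (binomial_poly_over r beta iota c) d /\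
          mult_at (binomial_poly_over r beta iota c) [ffun=> 0] mu),
        global_system r beta ->
          d = (\prod_(i < n) r i)%N /\
          mu%:Z = d%:Z - `|\det (exponent_mx r beta)|
      & ~ global_system r beta ->
          mu = (\prod_(i < n) r i)%N /\
          d%:Z = mu%:Z + `|\det (exponent_mx r beta)|].
Proof.
have [gl|ngl] := pselect (global_system r beta).
  have [mu muE gen] := global_generic iota char_k n_gt0 irr gl.
  exists (\prod_(i < n) r i)%N, mu; split=> // _; split=> //.
  by rewrite -muE PoszD -abszE addrK.
exists (\prod_(i < n) r i + `|\det (exponent_mx r beta)|)%N, (\prod_(i < n) r i)%N.
split=> [|//|_]; first exact: local_generic.
by rewrite PoszD -abszE.
Qed.
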